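(* Let $N\ge1$, $k\ge 0$ and $d\ge k+1$ be integers, let $f\in\mathcal B_N$, and let $\mathbf p=(\mathbf p_1,\dots,\mathbf p_N)\in(\mathbb R^d)^N$ be such that any $k+2$ of the points $\mathbf p_1,\dots,\mathbf p_N$ are affinely independent. Then $$V_{f,k}(\mathbf p)=\sum_{S\subseteq[N],\ |S|=k+1}\nu_{f,S,\mathbf p}\,\mathrm{vol}_k(\sigma_S).$$
   Context: $\mathrm{vol}_k$ is $k$-dimensional volume, $\kappa_n$ is the volume of the unit ball of $\mathbb R^n$ ($\kappa_0=1$). Boolean algebra. $\mathcal B_N$ is the free Boolean algebra generated by $x_1,\dots,x_N$, with operations $\cup,\cap$, complement $f\mapsto\bar f$, greatest element $X$, least element $\emptyset$; $f\setminus g=f\cap\bar g$, and $f\subseteq g$ means $f\cup g=g$. Put $[N]=\{1,\dots,N\}$. $\mathcal C_N\subset\mathcal B_N$ is the set of elements that can be built from $x_1,\dots,x_N$ using only $\cup,\cap,\setminus$. For $I\subseteq[N]$, $a_I=(\bigcap_{j\notin I}x_j)\setminus(\bigcup_{i\in I}x_i)$ are the atoms of $\mathcal B_N$ (an empty intersection is $X$, an empty union is $\emptyset$). The reduced Euler characteristic of $f\in\mathcal B_N$ is $\tilde\chi_N(f)=\sum_{a_I\subseteq f}(-1)^{|I|+1}$; the same definition is used, with $N$ replaced by $n$, for the free Boolean algebra on any $n$ generators. For $\emptyset\ne I\subseteq[N]$ let $u_I=\bigcup_{i\in I}x_i$. $\mathcal M_N$ is the space of functions $\mu:\mathcal C_N\to\mathbb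 R$ with $\mu(f\cup g)=\mu(f)+\mu(g)$ whenever $f\cap g=\emptyset$. For each $f\in\mathcal C_N$, the integers $m_{f,I}$ ($\emptyset\neq I\subseteq[N]$) are the unique ones such that $\mu(f)=\sum_{\emptyset\ne I\subseteq[N]}m_{f,I}\,\mu(u_I)$ for all $\mu\in\mathcal M_N$. The $0$-weight extension of $\mu\in\mathcal M_N$ is its unique extension $\mu:\mathcal B_N\to\mathbb R$ with $\mu(f\cup g)=\mu(f)+\mu(g)-\mu(f\cap g)$ for all $f,g\in\mathcal B_N$ and $\mu(X)=0$. Boolean intrinsic volumes. For a nonempty compact convex $K\subset\mathbb R^d$, the intrinsic volumes $V_k(K)$ are defined by Steiner's formula $\mathrm{vol}_d(K+B^d(\mathbf 0,r))=\sum_{k=0}^d\kappa_{d-k}V_k(K)r^{d-k}$, $r\ge 0$, where $B^d(\mathbf 0,r)$ is the closed ball of radius $r$ about the origin. $K_I(\mathbf p)$ is the convex hull of $\{\mathbf p_i:i\in I\}$. For $f\in\mathcal C_N$, $V_{f,k}(\mathbf p)=\sum_{\emptyset\ne I\subseteq[N]}m_{f,I}V_k(K_I(\mathbf p))$; the map $\mathcal C_N\ni f\mapsto V_{f,k}(\mathbf p)$ is in $\mathcal M_N$, and $V_{f,k}(\mathbf p)$ for arbitrary $f\in\mathcal B_N$ is defined by its $0$-weight extension. The numbers $\nu_{f,S,\mathbf p}$. For $S=\{i_1,\dots,i_{k+1}\}\subseteq[N]$ with $|S|=k+1$, $\sigma_S$ is the convex hull of $\mathbf p_{i_1},\dots,\mathbf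 p_{i_{k+1}}$, $\langle\sigma_S\rangle$ is its affine span, and $\mathbb S^{d-k-1}_S=\{\mathbf u\in\mathbb S^{d-1}:\mathbf u\perp\langle\sigma_S\rangle\}$. For $\mathbf u\in\mathbb S_S^{d-k-1}$, let $\Pi_+,\Pi_0,\Pi_-$ be the sets of $j\in[N]$ for which $\langle\mathbf p_j-\mathbf p_{i_1},\mathbf u\rangle$ is $>0$, $=0$, $<0$, respectively. Put $y_j=X$ if $j\in\Pi_+\cup(\Pi_0\setminus S)$, $y_j=x_j$ if $j\in S$, $y_j=\emptyset$ if $j\in\Pi_-$. Then $f(y_1,\dots,y_N)$ is an element of the free Boolean algebra generated by the $k+1$ elements $x_{i_1},\dots,x_{i_{k+1}}$, and we set $n_{f,S,\mathbf p}(\mathbf u)=(-1)^{k+1}\tilde\chi_{k+1}(f(y_1,\dots,y_N))$ and $$\nu_{f,S,\mathbf p}=\frac1{(d-k)\kappa_{d-k}}\int_{\mathbb S_S^{d-k-1}}n_{f,S,\mathbf p}(\mathbf u)\,\mathrm d\mathbf u,$$ the integral being with respect to the $(d-k-1)$-dimensional spherical measure (counting measure if $d=k+1$). A term with $\mathrm{vol}_k(\sigma_S)=0$ (possible only when $N=k+1$) is read as $0$. *)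

(* Defs.v *)
From HB Require Import structures.
From mathcomp Require Import all_boot all_order all_algebra.
From mathcomp Require Import all_classical all_reals all_analysis.
From mathcomp Require Import measurable_realfun.

Set Implicit Arguments.
Unset Strict Implicit.
Unset Printing Implicit Defensive.

Import Order.TTheory GRing.Theory Num.Theory.
Import numFieldNormedType.Exports.

Local Open Scope ring_scope.

(* The free Boolean algebra on the finite set of generators T, realised as the
   power set of the set of its atoms; the atom a_I is indexed by I : {set T}
   (see [atomE]), so that a_I lies below the generator x_j iff j \notin I.
   Freeness is expressed by [bsubst_gen], [bsubstU], [bsubstC], [bsubst_unique]. *)
Notation fba T := {set {set T}}.

Section FreeBooleanAlgebra.
Variable T : finType.
Implicit Types (f g : fba T) (I : {set T}).

Definition gen (j : T) : fba T := [set I : {set T} | j \notin I].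

Definition atom I : fba T :=
  (\bigcap_(j in ~: I) gen j) :\: (\bigcup_(i in I) gen i).

Definition red_euler f : int :=
  \sum_(I : {set T} | atom I \subset f) (-1) ^+ (#|I|.+1).

(* f(y), evaluated through the disjunctive normal form of f. *)
Definition bsubst (A : finType) (y : T -> {set A}) f : {set A} :=
  \bigcup_(I in f) ((\bigcap_(j in ~: I) y j) :\: (\bigcup_(i in I) y i)).

Inductive inC : fba T -> Prop :=
| inC_gen j : inC (gen j)
| inC_U f g : inC f -> inC g -> inC (f :|: g)
| inC_I f g : inC f -> inC g -> inC (f :&: g)
| inC_D f g : inC f -> inC g -> inC (f :\: g).

Definition uI I : fba T := \bigcup_(i in I) gen i.

(* [mu] represents an element of the space M_N; its values outside C_N are
   irrelevant. *)
Definition valuationC (R : realType) (mu : fba T -> R) : Prop :=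
  forall f g, inC f -> inC g -> f :&: g = finset.set0 ->
    mu (f :|: g) = mu f + mu g.

(* The condition [m finset.set0 = 0] only normalises an unused value. *)
Definition mcoef (R : realType) f : {set T} -> int :=
  xget (fun=> 0) [set m : {set T} -> int | m finset.set0 = 0 /\
    forall mu : fba T -> R, valuationC mu ->
      mu f = \sum_(I : {set T} | I != finset.set0) (m I)%:~R * mu (uI I)]%classic.

Definition ext0 (R : realType) (mu : fba T -> R) : fba T -> R :=
  xget (fun=> 0) [set nu : fba T -> R |
    [/\ forall f, inC f -> nu f = mu f,
        forall f g, nu (f :|: g) = nu f + nu g - nu (f :&: g)
      & nu [set: {set T}]%SET = 0]]%classic.

Lemma atomE I : atom I = [set I]%SET.
Proof.
apply/finset.setP => J; rewrite !inE; apply/andP/eqP => [[JU /bigcapP JI]|->].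
  apply/finset.setP => j; apply/idP/idP => jI.
    apply: contraLR jI => jI.
    by have := JI j; rewrite !inE => /(_ jI).
  apply: contraNT JU => jJ; apply/bigcupP; exists j => //.
  by rewrite inE.
split; last by apply/bigcapP => j; rewrite !inE.
by apply/negP => /bigcupP[i iI]; rewrite inE iI.
Qed.

Section Subst.
Variables (A : finType) (y : T -> {set A}).

Lemma in_bsubst f a : (a \in bsubst y f) = ([set j | a \notin y j]%SET \in f).
Proof.
apply/bigcupP/idP => [[I If]|aF].
  rewrite inE => /andP[aU /bigcapP aI]; suff -> : [set j | a \notin y j]%SET = I by [].
  apply/finset.setP => j; rewrite inE; apply/idP/idP => [jI|].
    by apply: contraNT jI => jI; apply: aI; rewrite inE.
  by move=> jI; apply: contraNN aU => ayj; apply/bigcupP; exists j.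
exists [set j | a \notin y j]%SET => //; rewrite inE; apply/andP; split.
  by apply/negP => /bigcupP[i]; rewrite inE => /negbTE ->.
by apply/bigcapP => j; rewrite !inE negbK.
Qed.

Lemma bsubst_gen j : bsubst y (gen j) = y j.
Proof. by apply/finset.setP => a; rewrite in_bsubst !inE negbK. Qed.

Lemma bsubstU f g : bsubst y (f :|: g) = bsubst y f :|: bsubst y g.
Proof. by apply/finset.setP => a; rewrite !inE !in_bsubst inE. Qed.

Lemma bsubstC f : bsubst y (~: f) = ~: bsubst y f.
Proof. by apply/finset.setP => a; rewrite !inE !in_bsubst inE. Qed.

Lemma bsubst_unique (h : fba T -> {set A}) :
  (forall j, h (gen j) = y j) ->
  (forall f g, h (f :|: g) = h f :|: h g) ->
  (forall f, h (~: f) = ~: h f) -> forall f, h f = bsubst y f.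
Proof.
move=> hg hU hC.
have hI f g : h (f :&: g) = h f :&: h g.
  by rewrite -[f :&: g]finset.setCK finset.setCI hC hU !hC finset.setCU !finset.setCK.
have hT : h [set: {set T}]%SET = [set: A]%SET.
  by rewrite -(finset.setUCr finset.set0) hU hC finset.setUCr.
have h0 : h finset.set0 = finset.set0 by rewrite -finset.setCT hC hT finset.setCT.
have hbI (I : {set T}) :
    h (\bigcap_(j in I) gen j) = \bigcap_(j in I) y j.
  by rewrite (big_morph h hI hT); apply: eq_bigr => j _; exact: hg.
have hbU (I : {set T}) :
    h (\bigcup_(j in I) gen j) = \bigcup_(j in I) y j.
  by rewrite (big_morph h hU h0); apply: eq_bigr => j _; exact: hg.
move=> f; have -> : h f = h (\bigcup_(I in f) atom I).
  congr h; apply/finset.setP => I; apply/idP/bigcupP => [If|[J Jf]].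
    by exists I => //; rewrite atomE inE.
  by rewrite atomE inE => /eqP ->.
rewrite (big_morph h hU h0); apply: eq_bigr => I _.
by rewrite /atom finset.setDE hI hC hbI hbU -finset.setDE.
Qed.

End Subst.

End FreeBooleanAlgebra.

Local Open Scope classical_set_scope.

Definition rV_display : measure_display.
Proof. exact: default_measure_display. Qed.

Section RowMeasurable.
Variables (R : realType) (n : nat).

Let coord (i : 'I_n) (x : 'rV[R]_n) : measurableTypeR R := x ord0 i.

Let rV_set0 : g_sigma_preimage coord set0.
Proof. exact: sigma_algebra0. Qed.

Let rV_setC A : g_sigma_preimage coord A -> g_sigma_preimage coord (~` A).
Proof. exact: sigma_algebraC. Qed.

Let rV_bigcup (F : (set 'rV[R]_n)^nat) : (forall i, g_sigma_preimage coord (F i)) ->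
  g_sigma_preimage coord (\bigcup_i (F i)).
Proof. exact: sigma_algebra_bigcup. Qed.

HB.instance Definition _ := @isMeasurable.Build rV_display
  'rV[R]_n (g_sigma_preimage coord) rV_set0 rV_setC rV_bigcup.

Lemma measurable_coord (i : 'I_n) :
  measurable_fun [set: 'rV[R]_n] (fun x : 'rV[R]_n => x ord0 i : measurableTypeR R).
Proof.
move=> _ Y mY; rewrite setTI; apply: sub_sigma_algebra => /=.
rewrite -bigcup_seq/=; exists i => /=; first by rewrite mem_index_enum.
by exists Y => //; rewrite setTI.
Qed.

Lemma measurable_rVP d (T : measurableType d) (f : T -> 'rV[R]_n) :
  (forall i, measurable_fun [set: T] (fun t => f t ord0 i : measurableTypeR R)) ->
  measurable_fun [set: T] f.
Proof.
move=> mf _ A mA; rewrite setTI.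
have : preimage_set_system setT f (g_sigma_preimage coord) (f @^-1` A).
  by exists A => //; rewrite setTI.
rewrite -g_sigma_preimage_comp; apply: smallest_sub.
  exact: sigma_algebra_measurable.
rewrite -bigcup_seq/=; apply: bigcup_sub => i _ B [C mC <-]; exact: mf.
Qed.

End RowMeasurable.

Section LebesgueStep.
Variables (R : realType) (n : nat).

Definition rVcons (z : measurableTypeR R * 'rV[R]_n) : 'rV[R]_n.+1 :=
  \row_j (if unlift ord0 j is Some i then z.2 ord0 i else z.1).

Lemma measurable_rVcons : measurable_fun setT rVcons.
Proof.
apply: measurable_rVP => j.
rewrite [X in measurable_fun _ X](_ : _ = fun z : measurableTypeR R * 'rV[R]_n =>
  if unlift ord0 j is Some i then z.2 ord0 i else z.1); last first.
  by apply/funext => z; rewrite mxE.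
case: unliftP => [i _|_]; last exact: measurable_fst.
exact: (measurableT_comp (measurable_coord i) measurable_snd).
Qed.

Lemma rVcons_proj (x : 'rV[R]_n.+1) :
  rVcons (x ord0 ord0, \row_i x ord0 (lift ord0 i)) = x.
Proof.
by apply/rowP => j; rewrite mxE; case: unliftP => [i ->|->]; rewrite ?mxE.
Qed.

Lemma rVcons_inj : injective rVcons.
Proof.
move=> [a u] [b v] /rowP uv; congr pair.
  by have := uv ord0; rewrite !mxE unlift_none.
by apply/rowP => i; have := uv (lift ord0 i); rewrite !mxE liftK.
Qed.

Variable mu : {sigma_finite_measure set 'rV[R]_n -> \bar R}.

Definition lebesgue_step : set 'rV[R]_n.+1 -> \bar R :=
  pushforward (lebesgue_measure \x mu)%E rVcons.

Let lebesgue_step0 : lebesgue_step set0 = 0%E.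
Proof. by have mf := measurable_rVcons; exact: measure0. Qed.

Let lebesgue_step_ge0 A : (0 <= lebesgue_step A)%E.
Proof. by have mf := measurable_rVcons; exact: measure_ge0. Qed.

Let lebesgue_step_sigma_additive : semi_sigma_additive lebesgue_step.
Proof.
by have mf := measurable_rVcons; exact: measure_semi_sigma_additive.
Qed.

HB.instance Definition _ := isMeasure.Build _ _ _ lebesgue_step
  lebesgue_step0 lebesgue_step_ge0 lebesgue_step_sigma_additive.

Let lebesgue_step_sigma_finite : sigma_finite setT lebesgue_step.
Proof.
have /sigma_finiteP[F [FT ndF Foo]] := sigma_finiteT (@lebesgue_measure R).
have /sigma_finiteP[G [GT ndG Goo]] := sigma_finiteT mu.
pose proj (x : 'rV[R]_n.+1) : measurableTypeR R * 'rV[R]_n :=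
  (x ord0 ord0, \row_i x ord0 (lift ord0 i)).
have mproj : measurable_fun setT proj.
  apply: measurable_fun_pair; first exact: measurable_coord.
  apply: measurable_rVP => i.
  rewrite [X in measurable_fun _ X](_ : _ = fun x : 'rV[R]_n.+1 =>
    x ord0 (lift ord0 i)); last by apply/funext => x; rewrite mxE.
  exact: measurable_coord.
exists (fun i => proj @^-1` (F i `*` G i)).
  apply/seteqP; split => // x _.
  have [i _ Fi] : (\bigcup_i F i) (proj x).1 by rewrite -FT.
  have [j _ Gj] : (\bigcup_i G i) (proj x).2 by rewrite -GT.
  exists (maxn i j) => //; split.
    by move: Fi; exact/subsetPset/ndF/leq_maxl.
  by move: Gj; exact/subsetPset/ndG/leq_maxr.
move=> i; have [mF Fi] := Foo i; have [mG Gi] := Goo i; split.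
  by rewrite -[X in measurable X]setTI; apply: mproj => //; exact: measurableX.
rewrite /lebesgue_step /pushforward -comp_preimage.
rewrite [X in (_ X < _)%E](_ : _ = F i `*` G i).
  by rewrite product_measure1E// lte_mul_pinfty// ge0_fin_numE.
have projK z : proj (rVcons z) = z by apply: rVcons_inj; exact: rVcons_proj.
have -> : proj \o rVcons = id by apply/funext => z; exact: projK.
by rewrite preimage_id.
Qed.

HB.instance Definition _ := Measure_isSigmaFinite.Build _ _ _ lebesgue_step
  lebesgue_step_sigma_finite.

End LebesgueStep.

(* Lebesgue measure on R^n, as an iterated product of the one on R. *)
Fixpoint lebesgueV (R : realType) (n : nat) :
    {sigma_finite_measure set 'rV[R]_n -> \bar R} :=
  match n with
  | 0 => dirac (0 : 'rV[R]_0)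
  | m.+1 => lebesgue_step (lebesgueV R m)
  end.

Section Euclidean.
Variables (R : realType) (d : nat).
Implicit Types (x y : 'rV[R]_d).

Definition dotv x y : R := \sum_(i < d) x ord0 i * y ord0 i.

(* The library norm on row vectors is the sup norm. *)
Definition enorm x : R := Num.sqrt (dotv x x).

Definition eball (r : R) : set 'rV[R]_d := [set x | enorm x <= r].

Definition usphere : set 'rV[R]_d := [set x | enorm x = 1].

Definition normalize x : 'rV[R]_d := (enorm x)^-1 *: x.

Lemma measurable_enorm_powR (p : R) :
  measurable_fun [set: 'rV[R]_d] (fun x => enorm x `^ p : measurableTypeR R).
Proof.
rewrite (_ : (fun _ => _) = fun x => (dotv x x `^ 2^-1) `^ p); last first.
  apply/funext => x; rewrite powR12_sqrt//.
  by apply: sumr_ge0 => i _; rewrite -expr2 sqr_ge0.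
apply: (measurableT_comp (measurable_powR _)).
apply: (measurableT_comp (measurable_powR _)).
by apply: measurable_sum => i; apply: measurable_funM; exact: measurable_coord.
Qed.

Lemma measurable_eball r : measurable (eball r).
Proof.
have := measurable_enorm_powR 1 measurableT (measurable_itv (`]-oo, r])%R).
rewrite setTI; congr (measurable _); apply/seteqP.
by split => x /=; rewrite in_itv/= powRr1// sqrtr_ge0.
Qed.

Lemma measurable_normalize : measurable_fun setT normalize.
Proof.
apply: measurable_rVP => i.
rewrite (_ : (fun _ => _) = fun x => enorm x `^ (-1) * x ord0 i).
  apply: measurable_funM; first exact: measurable_enorm_powR.
  exact: measurable_coord.
by apply/funext => x; rewrite mxE powR_inv1// sqrtr_ge0.
Qed.

Definition kappa : R := fine (lebesgueV R d (eball 1)).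

(* Spherical (surface) measure of the unit sphere of R^d, d >= 1: the measure
   of A is d times the volume of the cone {t u | u in A, 0 < t <= 1}.  On
   the sphere {-1, 1} of R^1 it is the counting measure. *)
Definition spherical_measure (A : set 'rV[R]_d) : \bar R :=
  (d%:R%:E * lebesgueV R d (normalize @^-1` A `&` eball 1))%E.

Let cone_measure : set 'rV[R]_d -> \bar R :=
  pushforward (mrestr (lebesgueV R d) (measurable_eball 1)) normalize.

Let cone0 : cone_measure set0 = 0%E.
Proof. by have mf := measurable_normalize; exact: measure0. Qed.

Let cone_ge0 A : (0 <= cone_measure A)%E.
Proof. by have mf := measurable_normalize; exact: measure_ge0. Qed.

Let cone_sigma_additive : semi_sigma_additive cone_measure.
Proof.
by have mf := measurable_normalize; exact: measure_semi_sigma_additive.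
Qed.

HB.instance Definition _ := isMeasure.Build _ _ _ cone_measure
  cone0 cone_ge0 cone_sigma_additive.

Let spherical_measureE : spherical_measure = mscale d%:R%:nng cone_measure.
Proof. by []. Qed.

Let spherical_measure0 : spherical_measure set0 = 0%E.
Proof. by rewrite spherical_measureE measure0. Qed.

Let spherical_measure_ge0 A : (0 <= spherical_measure A)%E.
Proof. by rewrite spherical_measureE; exact: measure_ge0. Qed.

Let spherical_measure_sigma_additive : semi_sigma_additive spherical_measure.
Proof. by rewrite spherical_measureE; exact: measure_semi_sigma_additive. Qed.

HB.instance Definition _ := isMeasure.Build _ _ _ spherical_measure
  spherical_measure0 spherical_measure_ge0 spherical_measure_sigma_additive.

End Euclidean.

Arguments usphere R d : clear implicits.
Arguments spherical_measure R d : clear implicits.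

Section Volumes.
Variables (R : realType) (d : nat).
Implicit Types (A K : set 'rV[R]_d).

Definition conv_hull A : set 'rV[R]_d := smallest (@convex_set R 'rV[R]_d) A.

(* k-dimensional volume of a set A lying in some k-dimensional affine subspace
   of R^d: Lebesgue measure of A read in an orthonormal coordinate system
   v |-> q + v *m E of such a subspace. *)
Definition kvol (k : nat) A : R :=
  let qE := xget (0, 0) [set qE : 'rV[R]_d * 'M[R]_(k, d) |
    qE.2 *m qE.2^T = 1%:M /\ A `<=` range (fun v => qE.1 + v *m qE.2)] in
  fine (lebesgueV R k [set v | A (qE.1 + v *m qE.2)]).

(* The intrinsic volumes of K, as the coefficients in Steiner's formula (with
   the usual convention V_j = 0 for j > d). *)
Definition intrinsic_volume (k : nat) K : R :=
  xget (fun=> 0) [set V : nat -> R | (forall j, (d < j)%N -> V j = 0) /\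
    forall r : R, 0 <= r ->
      lebesgueV R d [set x + y | x in K & y in eball r] =
      (\sum_(j < d.+1) kappa R (d - j) * V j * r ^+ (d - j))%:E] k.

End Volumes.

Section BooleanIntrinsicVolumes.
Variables (R : realType) (N d : nat).
Implicit Types (f : fba 'I_N) (S I : {set 'I_N}) (p : 'I_N -> 'rV[R]_d)
  (u : 'rV[R]_d).

Definition points_hull p I : set 'rV[R]_d := conv_hull (p @` [set` I]).

Definition aff_span p S : set 'rV[R]_d :=
  [set \sum_(i in S) c i *: p i |
     c in [set c : 'I_N -> R | \sum_(i in S) c i = 1]].

Definition aff_indep p S : Prop :=
  forall c : 'I_N -> R, \sum_(i in S) c i = 0 ->
    \sum_(i in S) c i *: p i = 0 -> forall i, i \in S -> c i = 0.

Definition bool_intrinsic_volume (k : nat) p f : R :=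
  ext0 (fun g : fba 'I_N => \sum_(I : {set 'I_N} | I != finset.set0)
          (mcoef R g I)%:~R * intrinsic_volume k (points_hull p I)) f.

Definition perp_sphere p S : set 'rV[R]_d :=
  [set u | enorm u = 1 /\
    forall x y, aff_span p S x -> aff_span p S y -> dotv u (x - y) = 0].

(* A matrix with orthonormal rows inducing an isometry from the unit sphere of
   R^m onto [perp_sphere p S]; it exists as soon as the direction of the affine
   span has codimension m. *)
Definition perp_frame (m : nat) p S : 'M[R]_(m, d) :=
  xget 0 [set E : 'M[R]_(m, d) | E *m E^T = 1%:M /\
    (fun v : 'rV[R]_m => v *m E) @` usphere R m = perp_sphere p S].

(* [head j (enum S)] is the least element of S (S being nonempty). The
   indices j in S take precedence; for u in [perp_sphere p S] they are all in
   Pi_0, so the order of the tests is immaterial. *)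
Definition subst_arg p S u (j : 'I_N) : fba {i : 'I_N | i \in S} :=
  if insub j is Some i then gen i
  else if dotv (p j - p (head j (enum S))) u < 0 then finset.set0
  else finset.setT.

Definition ncoef f S p u : int :=
  (-1) ^+ #|S| * red_euler (bsubst (subst_arg p S u) f).

(* Here #|S| = k + 1; the integral over [perp_sphere p S] is computed in the
   isometric parametrisation [perp_frame]. *)
Definition nu (k : nat) f S p : R :=
  ((d - k)%:R * kappa R (d - k))^-1 *
  \int[spherical_measure R (d - k)]_(v in usphere R (d - k))
     (ncoef f S p (v *m perp_frame (d - k) p S))%:~R.

End BooleanIntrinsicVolumes.

(* Main.v *)
From HB Require Import structures.
Require Import Defs.
From mathcomp Require Import all_boot all_order all_algebra.
From mathcomp Require Import all_classical all_reals all_analysis.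
From mathcomp Require Import measurable_realfun.
From mathcomp Require Import ring lra zify.

(**
Both sides of the formula are modular in f and vanish at the least and the greatest
element of the Boolean algebra.  Moebius inversion over the atoms ([mcoefP]) shows
that such a function is determined by its values on the unions u_I ([ext0_basis]),
so the theorem only has to be checked for f = u_I, where the left-hand side is the
intrinsic volume V_k of the polytope P = conv {p_i : i in I}.

For f = u_I the integer n_{f,S}(u) is 1 if S is contained in I and the linear form given
by u is strictly larger at the points of S than at the other points of I, and 0 otherwise
([ncoef_uI]).  Hence nu_{f,S} is the external angle of P at the simplex S ([nu_uI]), and
what remains is the classical formula
  V_k(P) = sum over the k-faces F of P of (external angle at F) * vol_k(F).

This is obtained from Steiner's formula.  To a point x attach its nearest point y in P
and the set J of those i in I at which p_i maximises the linear form given by the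
vector u = x - y.  Then y lies in conv p_J, and u in the relatively open cone C_J of
the vectors whose maximisers are exactly J; conversely every such sum y + u arises from
a unique (J, y).  So the sets conv p_J + C_J partition the whole space
([normal_decomposition], [normal_decomposition_unique]); indexing the pieces by the
maximisers of u, and not by the face containing y in its relative interior, avoids any
theory of faces.  As C_J is orthogonal to the affine span of p_J, the part of a piece at
distance at most r from P is a product, of volume
  vol_j(conv p_J) * vol_(d-j)(C_J cap B) * r^(d-j),
where j is the dimension of p_J ([piece_volume]).  Summation over J and comparison of
the coefficients of the resulting polynomial in r give all the intrinsic volumes
([intrinsic_volume_hull]).  Under the independence hypothesis the J of dimension k
have k + 1 elements ([rank_dirmx_card]); conversely a set S of k + 1 points that spans
a smaller dimension has kvol k = 0 ([kvol_degenerate]).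

The product formula needs that Lebesgue measure, defined by iterating one-dimensional
products, is compatible with orthonormal coordinates.  This follows from the
uniqueness of translation-invariant measures ([haar_unique]), itself a short
consequence of interchanging the order of integration ([haar_swap]).
*)

Set Implicit Arguments.
Unset Strict Implicit.
Unset Printing Implicit Defensive.

Import Order.TTheory GRing.Theory Num.Theory.
Import numFieldNormedType.Exports.
Local Open Scope ring_scope.

(** * Valuations on the free Boolean algebra *)

Section BooleanPart.
Variables (T : finType) (t0 : T).
Implicit Types (f g : fba T) (I J K : {set T}).

Lemma red_eulerE f : red_euler f = \sum_(I in f) (-1) ^+ (#|I|.+1).
Proof. by apply: eq_bigl => I; rewrite atomE finset.sub1set. Qed.

Lemma in_uI I J : (J \in uI I) = ~~ (I \subset J).
Proof.
apply/bigcupP/subsetPn => [[i iI]|[i iI iJ]]; first by rewrite inE; exists i.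
by exists i; rewrite // inE.
Qed.

Lemma inC0 : inC (finset.set0 : fba T).
Proof. by rewrite -(finset.setDv (gen t0)); apply: inC_D; exact: inC_gen. Qed.

Lemma inC_atom J : J != [set: T]%SET -> inC (atom J).
Proof.
move=> JT; have [j0 jJ] : exists j0, j0 \in ~: J.
  by apply/set0Pn; apply: contra JT => /eqP h; rewrite -[J]finset.setCK h finset.setC0.
apply: inC_D; last by elim/big_ind: _ => [|*|*]; [exact: inC0|exact: inC_U|exact: inC_gen].
rewrite (big_setD1 j0) //=; elim/big_rec: _ => [|i X _ h].
  by rewrite finset.setIT; exact: inC_gen.
by rewrite finset.setICA; apply: inC_I => //; exact: inC_gen.
Qed.

Lemma bigcup_atoms f : \bigcup_(J in f) atom J = f.
Proof.
apply/finset.setP => J; apply/bigcupP/idP => [[K Kf]|Jf]; first by rewrite atomE inE => /eqP ->.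
by exists J; rewrite // atomE inE.
Qed.

Lemma inCP f : inC f <-> [set: T]%SET \notin f.
Proof.
split => [|h].
  elim=> {f} [j|f g _ hf _ hg|f g _ hf _ hg|f g _ hf _ hg]; rewrite !inE ?negbK //.
  - by rewrite negb_or hf.
  - by rewrite negb_and hf.
  - by rewrite negb_and hf orbT.
rewrite -(bigcup_atoms f); elim/big_ind: _ => [|*|J Jf]; [exact: inC0|exact: inC_U|].
by apply: inC_atom; apply: contraNneq h => <-.
Qed.

(** Toggling an element of K that is not in J is a sign-reversing involution. *)
Lemma alternating_interval J K :
  \sum_(I : {set T} | (J \subset I) && (I \subset K)) (-1) ^+ #|I| =
  (if J == K then (-1) ^+ #|J| else 0) :> int.
Proof.
case: eqP => [<-|/eqP JK].
  rewrite (big_pred1 J) // => I /=; by rewrite -finset.eqEsubset eq_sym.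
have [sJK|nJK] := boolP (J \subset K); last first.
  rewrite big1 // => I /andP[JI IK]; by rewrite (fintype.subset_trans JI IK) in nJK.
have [x xK xJ] : exists2 x, x \in K & x \notin J.
  by apply/subsetPn; apply: contra JK => KJ; rewrite finset.eqEsubset sJK.
pose t I := if x \in I then I :\ x else x |: I.
have xt I : (x \in t I) = (x \notin I).
  by rewrite /t; case: ifPn => h; rewrite !inE eqxx.
have tt : involutive t.
  move=> I; rewrite {1}/t xt /t; case: (boolP (x \in I)) => xI /=.
    by rewrite finset.setD1K.
  by rewrite setU1K.
have jt I : ((J \subset t I) && (t I \subset K)) = ((J \subset I) && (I \subset K)).
  rewrite /t; case: ifPn => xI.
    rewrite subsetD1 xJ andbT; congr (_ && _); rewrite subDset.
    by rewrite (finset.setUidPr _) // finset.sub1set.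
  rewrite finset.subUset finset.sub1set xK /=; congr (_ && _).
  apply/fintype.subsetP/fintype.subsetP => h y yJ; have := h y yJ; rewrite !inE.
    by case/orP => // /eqP e; move: xJ; rewrite -e yJ.
  by move=> ->; rewrite orbT.
set S := bigop.body _ _ _.
have : S = - S.
  rewrite {1}/S (reindex_inj (inv_inj tt)) /= (eq_bigl _ _ jt) -sumrN; apply: eq_bigr => I _.
  rewrite /t; case: ifPn => xI; last by rewrite cardsU1 xI exprS mulN1r.
  by rewrite [in RHS](cardsD1 x) xI exprS mulN1r opprK.
by move: S => s; lia.
Qed.

Lemma alternating_sub J : \sum_(I : {set T} | J \subset I) (-1) ^+ #|I| =
  (if J == [set: T]%SET then (-1) ^+ #|J| else 0) :> int.
Proof.
by rewrite -alternating_interval; apply: eq_bigl => I; rewrite finset.subsetT andbT.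
Qed.

(** The atom a_K lies below u_I iff I is not contained in K, so this inverts the matrix that
    expresses the values mu u_I as sums of the values at the atoms. *)
Lemma moebius_kernel J K : J != [set: T]%SET ->
  \sum_(I : {set T} | (J \subset I) && ~~ (I \subset K)) (-1) ^+ (#|I| + #|J|).+1 =
  (J == K)%:R :> int.
Proof.
move=> JT; have := alternating_sub J.
rewrite (negbTE JT) (bigID (fun I => I \subset K)) /= alternating_interval => h.
under eq_bigr do rewrite exprS mulN1r exprD.
rewrite sumrN -mulr_suml.
have -> : \sum_(I : {set T} | (J \subset I) && ~~ (I \subset K)) (-1) ^+ #|I| =
  - (if J == K then (-1) ^+ #|J| else 0) :> int by apply/eqP; rewrite -addr_eq0 addrC h.
by case: eqP => [_|_]; rewrite mulNr opprK ?mul0r // -exprD addnn -signr_odd odd_double.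
Qed.

Section Valuations.
Variable R : realType.

Lemma valuationC0 (mu : fba T -> R) : valuationC mu -> mu finset.set0 = 0.
Proof.
move=> hmu; have := hmu _ _ inC0 inC0 (finset.setI0 _).
by rewrite finset.setU0 => /esym/eqP; rewrite -subr_eq0 addrK => /eqP.
Qed.

(** All atoms but one, the complement of the union of the generators, can be built from the
    generators by unions, intersections and differences. *)
Lemma valuationC_atoms (mu : fba T -> R) f : valuationC mu -> inC f ->
  mu f = \sum_(J in f) mu (atom J).
Proof.
move=> hmu; elim: {f}#|f| {-2}f (erefl #|f|) => [|n IH] f cf /inCP fC.
  by move/cards0_eq: cf => ->; rewrite big_set0 valuationC0.
have /card_gt0P[J Jf] : (0 < #|f|)%N by rewrite cf.
rewrite (big_setD1 J) //= -IH; last 2 first.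
- by have := cardsD1 J f; rewrite Jf cf => -[].
- by apply/inCP; rewrite in_setD1 negb_and fC orbT.
rewrite -hmu.
- by rewrite atomE finset.setD1K.
- by apply: inC_atom; apply: contraNneq fC => <-.
- by apply/inCP; rewrite in_setD1 negb_and fC orbT.
by rewrite atomE; apply/finset.setP => K; rewrite !inE; case: eqP.
Qed.

Definition moebius_coef f I : int :=
  if I == finset.set0 then 0 else \sum_(J in f | J \subset I) (-1) ^+ (#|I| + #|J|).+1.

Lemma moebius_coefP f (mu : fba T -> R) : inC f -> valuationC mu ->
  mu f = \sum_(I : {set T} | I != finset.set0) (moebius_coef f I)%:~R * mu (uI I).
Proof.
move=> fC hmu; have /inCP fT := fC.
have uC I : inC (uI I) by apply/inCP; rewrite in_uI negbK finset.subsetT.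
pose c I J K : int := if (J \subset I) && ~~ (I \subset K) then (-1) ^+ (#|I| + #|J|).+1 else 0.
transitivity (\sum_(I : {set T}) \sum_(J in f) \sum_(K : {set T}) (c I J K)%:~R * mu (atom K)); last first.
  rewrite [RHS]big_mkcond /=; apply: eq_bigr => I _; case: ifPn => [I0|]; last first.
    rewrite negbK => /eqP ->; rewrite big1 // => J _; rewrite big1 // => K _.
    by rewrite /c finset.sub0set andbF mul0r.
  rewrite /moebius_coef (negbTE I0) rmorph_sum mulr_suml big_mkcondr /=; apply: eq_bigr => J _.
  case: ifPn => JI; last by rewrite big1 // => K _; rewrite /c (negbTE JI) mul0r.
  rewrite (valuationC_atoms hmu (uC I)) mulr_sumr [RHS]big_mkcond /=; apply: eq_bigr => K _.
  by rewrite in_uI /c JI /=; case: ifP => _; rewrite ?mul0r.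
rewrite exchange_big (valuationC_atoms hmu fC) /=; apply: eq_bigr => J Jf.
rewrite exchange_big /=.
have JT : J != [set: T]%SET by apply: contraNneq fT => <-.
transitivity (\sum_K (J == K)%:R * mu (atom K)).
  rewrite (bigD1 J) //= eqxx mul1r big1 ?addr0 // => K.
  by rewrite eq_sym => /negbTE ->; rewrite mul0r.
apply: eq_bigr => K _; rewrite -mulr_suml; congr (_ * _).
have := moebius_kernel K JT; rewrite big_mkcond /= => h.
by rewrite -rmorph_sum /= h; case: eqP.
Qed.

Lemma mcoefP f (mu : fba T -> R) : inC f -> valuationC mu ->
  mu f = \sum_(I : {set T} | I != finset.set0) (mcoef R f I)%:~R * mu (uI I).
Proof.
move=> fC hmu; rewrite /mcoef; set Q := (X in xget _ X).
have : exists m, Q m.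
  exists (moebius_coef f); split; first by rewrite /moebius_coef eqxx.
  by move=> mu' hmu'; exact: moebius_coefP.
by move=> /(xgetPex (fun=> 0)) [_]; apply.
Qed.

Definition modular (W : fba T -> R) := forall f g, W (f :|: g) = W f + W g - W (f :&: g).

(** By [inCP] every element or its complement satisfies inC, so modularity and the value at X
    leave no freedom. *)
Lemma ext0_unique (mu W : fba T -> R) : (forall f, inC f -> W f = mu f) -> modular W ->
  W [set: {set T}]%SET = 0 -> ext0 mu = W.
Proof.
move=> hW mW WT; apply: xget_unique => // nu [nuC mnu nu_setT]; apply/funext => f.
have [fT|fT] := boolP ([set: T]%SET \in f); last by rewrite nuC ?hW //; exact/inCP.
have C1 : inC (~: f) by apply/inCP; rewrite inE fT.
have := mnu f (~: f); have := mW f (~: f).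
rewrite finset.setUCr finset.setICr nu_setT WT (nuC _ C1) (nuC _ inC0) (hW _ C1) (hW _ inC0).
by move=> h1 h2; move: h1; rewrite h2 => /addIr/addIr.
Qed.

Lemma ext0_basis (W : fba T -> R) (v : {set T} -> R) : modular W -> W finset.set0 = 0 ->
  W [set: {set T}]%SET = 0 -> (forall I, I != finset.set0 -> W (uI I) = v I) ->
  ext0 (fun g => \sum_(I : {set T} | I != finset.set0) (mcoef R g I)%:~R * v I) = W.
Proof.
move=> mW W0 WT hv; apply: ext0_unique => // f fC.
rewrite (mcoefP fC (mu := W)); first by apply: eq_bigr => I I0; rewrite hv.
by move=> g h _ _ gh; rewrite mW gh W0 subr0.
Qed.

End Valuations.
End BooleanPart.

(** * Uniqueness of translation-invariant measures *)

Local Open Scope classical_set_scope.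

Local Notation pushforward_measure :=
  measure_function.measure_function_pushforward__canonical__measure_function_Measure.

Lemma measurable_preimageT d1 d2 (T1 : measurableType d1) (T2 : measurableType d2)
    (f : T1 -> T2) (A : set T2) :
  measurable_fun setT f -> measurable A -> measurable (f @^-1` A).
Proof. by move=> mf mA; rewrite -[X in measurable X]setTI; exact: mf. Qed.

Section ProductShift.
Context d1 d2 (T1 : measurableType d1) (T2 : measurableType d2) (R : realType).
Variables (m1 : {sigma_finite_measure set T1 -> \bar R})
  (m2 : {sigma_finite_measure set T2 -> \bar R}).
Variables (f1 : T1 -> T1) (f2 : T2 -> T2).
Hypotheses (mf1 : measurable_fun setT f1) (mf2 : measurable_fun setT f2).
Hypothesis f1E : forall A, measurable A -> m1 (f1 @^-1` A) = m1 A.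
Hypothesis f2E : forall A, measurable A -> m2 (f2 @^-1` A) = m2 A.

Lemma product_measure_preserved (X : set (T1 * T2)) : measurable X ->
  (m1 \x m2)%E ((fun z => (f1 z.1, f2 z.2)) @^-1` X) = (m1 \x m2)%E X.
Proof.
move=> mX; have mf : measurable_fun setT (fun z : T1 * T2 => (f1 z.1, f2 z.2)).
  by apply: measurable_fun_pair; exact: measurableT_comp.
apply/esym.
rewrite (product_measure_unique
  (m' := pushforward_measure (m1 \x m2)%E mf)) // => A B mA mB.
rewrite /= /pushforward.
rewrite [X in product_measure1 _ _ X](_ : _ = (f1 @^-1` A) `*` (f2 @^-1` B)) //.
have mA1 := measurable_preimageT mf1 mA; have mB1 := measurable_preimageT mf2 mB.
rewrite product_measure1E //; congr (_ * _)%E; [exact: f1E|exact: f2E].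
Qed.

End ProductShift.

Definition cube (R : realType) n (a b : R) : set 'rV[R]_n :=
  [set x | forall i, a <= x ord0 i <= b].
Arguments cube {R} n a b.

Section LebesgueV.
Variable R : realType.
Local Notation lam := (lebesgueV R).

Lemma lebesgue_measure_shift (t : R) (A : set R) : measurable A ->
  lebesgue_measure ((fun x : measurableTypeR R => x + t) @^-1` A)
  = lebesgue_measure A.
Proof.
move=> mA; have mf : measurable_fun setT (fun x : measurableTypeR R => x + t : measurableTypeR R).
  by apply: measurable_funD => //; exact: measurable_cst.
apply/esym/(@lebesgue_measure_unique R
  (pushforward_measure lebesgue_measure mf)) => //= _ [[a b]] _ <-.
rewrite /pushforward /=.
have -> : (fun x : R => x + t) @^-1` `]a, b] = `]a - t, b - t].
  by apply/seteqP; split => x /=; rewrite !in_itv/=; lra.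
by rewrite !lebesgue_measure_itv/= !lte_fin -!EFinD ltrD2r; congr (if _ then _ else _);
  congr (_%:E); lra.
Qed.

Lemma measurable_rV_shift n (t : 'rV[R]_n) : measurable_fun setT (fun x : 'rV[R]_n => x + t).
Proof.
apply: measurable_rVP => i.
rewrite (_ : (fun _ => _) = fun x : 'rV[R]_n => x ord0 i + t ord0 i);
  last by apply/funext => x; rewrite mxE.
by apply: measurable_funD; [exact: measurable_coord|exact: measurable_cst].
Qed.

Lemma lebesgueVS n A : lam n.+1 A = (lebesgue_measure \x lam n)%E (@rVcons R n @^-1` A).
Proof. by []. Qed.

Lemma measurable_preimage_rVcons n (A : set 'rV[R]_n.+1) :
  measurable A -> measurable (@rVcons R n @^-1` A).
Proof.
by move=> mA; apply: measurable_preimageT => //; exact: measurable_rVcons.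
Qed.

Lemma lebesgueV_shift n (t : 'rV[R]_n) (A : set 'rV[R]_n) : measurable A ->
  lam n ((fun x => x + t) @^-1` A) = lam n A.
Proof.
elim: n t A => [|n IH] t A mA.
  congr (lam 0%N _); apply/seteqP; split=> x /=; suff -> : x + t = x by [].
    by rewrite (thinmx0 t) addr0.
  by rewrite (thinmx0 t) addr0.
rewrite !lebesgueVS.
pose t' := \row_i t ord0 (lift ord0 i) : 'rV[R]_n.
have -> : @rVcons R n @^-1` ((fun x => x + t) @^-1` A) =
  (fun z : measurableTypeR R * 'rV[R]_n =>
    (z.1 + t ord0 ord0 : measurableTypeR R, z.2 + t')) @^-1` (@rVcons R n @^-1` A).
  apply/seteqP; split => z /=; congr A; apply/rowP => j; rewrite !mxE.
    by case: unliftP => [i ->|->] /=; rewrite ?mxE.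
  by case: unliftP => [i ->|->] /=; rewrite ?mxE.
apply: (@product_measure_preserved _ _ (measurableTypeR R) 'rV[R]_n R lebesgue_measure (lam n)
  (fun x => x + t ord0 ord0 : measurableTypeR R) (fun x => x + t')).
- by apply: measurable_funD => //; exact: measurable_cst.
- exact: measurable_rV_shift.
- by move=> B mB; exact: lebesgue_measure_shift.
- exact: IH.
- exact: measurable_preimage_rVcons.
Qed.

Lemma measurable_cube n a b : measurable (cube n a b : set 'rV[R]_n).
Proof.
rewrite (_ : cube n a b = \bigcap_(i in [set: 'I_n]) ((fun x : 'rV[R]_n =>
  x ord0 i : measurableTypeR R) @^-1` `[a, b])).
  apply: fin_bigcap_measurable => // i _.
  exact: (measurable_preimageT (@measurable_coord R n i)).
apply/seteqP; split => x /= h i; first by move=> _ /=; rewrite ?in_itv /= h.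
by have := h i I; rewrite ?in_itv.
Qed.

Lemma lebesgueV_cube n a b : a <= b -> lam n (cube n a b) = ((b - a) ^+ n)%:E.
Proof.
move=> ab; elim: n => [|n IH].
  by rewrite /= /dirac /= indicE mem_set // => -[].
rewrite lebesgueVS.
rewrite (_ : @rVcons R n @^-1` _ = `[a, b] `*` cube n a b).
  transitivity (@lebesgue_measure R `[a, b] * lam n (cube n a b))%E.
    by apply: product_measure1E => //; exact: measurable_cube.
  rewrite IH lebesgue_measure_itv /= lte_fin.
  move: ab; rewrite le_eqVlt => /orP[/eqP ->|->];
    rewrite ?ltxx ?mul0e ?subrr ?expr0n ?exprS//=; rewrite ?mul0r//.
apply/seteqP; split => [[x y]|[x y]] /=.
  move=> h; split => /=; first by have := h ord0; rewrite in_itv /= mxE unlift_none.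
  by move=> i; have := h (lift ord0 i); rewrite mxE liftK.
by rewrite in_itv /= => -[h1 h2] i; rewrite mxE; case: unliftP => [j _|_].
Qed.

Lemma lebesgueV_cube_fin n a b : (lam n (cube n a b) < +oo)%E.
Proof.
have [ab|ba] := leP a b; first by rewrite lebesgueV_cube// ltry.
apply: (@le_lt_trans _ _ (lam n (cube n b a))).
  apply: le_measure; rewrite ?inE; try exact: measurable_cube.
  by move=> x /= h i; have := h i; move: ba; lra.
by rewrite lebesgueV_cube ?ltry// ltW.
Qed.

End LebesgueV.

Section Haar.
Variables (R : realType) (n : nat).
Local Notation lam := (lebesgueV R n).
Implicit Types A B : set 'rV[R]_n.

Lemma measurable_rV_add : measurable_fun setT (fun z : 'rV[R]_n * 'rV[R]_n => z.1 + z.2).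
Proof.
apply: measurable_rVP => i.
rewrite (_ : (fun _ => _) = fun z : 'rV[R]_n * 'rV[R]_n => z.1 ord0 i + z.2 ord0 i);
  last by apply/funext => x; rewrite mxE.
apply: measurable_funD.
  exact: (measurableT_comp (measurable_coord i) measurable_fst).
exact: (measurableT_comp (measurable_coord i) measurable_snd).
Qed.

Lemma measurable_rV_opp : measurable_fun setT (fun x : 'rV[R]_n => - x).
Proof.
apply: measurable_rVP => i.
rewrite (_ : (fun _ => _) = fun z : 'rV[R]_n => - (z ord0 i));
  last by apply/funext => x; rewrite mxE.
exact: (measurable_funN (measurable_coord i)).
Qed.

Section Swap.
Variable mu : {sigma_finite_measure set 'rV[R]_n -> \bar R}.
Hypothesis inv : forall t A, measurable A -> mu ((fun x => x + t) @^-1` A) = mu A.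

Lemma product_measure_exchange G : measurable G -> (mu \x lam)%E G = (mu \x^ lam)%E G.
Proof.
by move=> mG; apply: product_measure_unique => // A B mA mB; exact: product_measure2E.
Qed.

Lemma product_slices (G : set ('rV[R]_n * 'rV[R]_n)) A (c : \bar R) : measurable A ->
  measurable G -> (0 <= c)%E ->
  (forall x, A x -> lam (xsection G x) = c) -> (forall x, ~ A x -> xsection G x = set0) ->
  (mu \x lam)%E G = (mu A * c)%E.
Proof.
move=> mA mG c0 h1 h2; rewrite /product_measure1 /=.
rewrite (eq_integral (fun x => (\1_A x)%:E * c)%E); last first.
  move=> x _; rewrite indicE; have [xA|xA] /= := boolP (x \in A).
    by rewrite h1 ?mul1e//; move: xA; rewrite inE.
  by rewrite mul0e h2 ?measure0//; move: xA; rewrite notin_setE.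
by rewrite ge0_integralZr ?integral_indic ?setIT//; exact: measurableT_comp.
Qed.

(** Consider the pairs (x, y) with x in A and x + y in B.  For fixed x the y form a translate
    of B, so the mass of these pairs is mu A * lam B.  For fixed y the x form a translate of
    those with x in B and x - y in A; fixing x in the new pairs gives mu B * lam (- A). *)
Lemma haar_swap A B : measurable A -> measurable B ->
  (mu A * lam B)%E = (mu B * lam ((fun x => - x)%R @^-1` A))%E.
Proof.
move=> mA mB.
pose G : set ('rV[R]_n * 'rV[R]_n) := (fst @^-1` A) `&` ((fun z => z.1 + z.2) @^-1` B).
pose G' : set ('rV[R]_n * 'rV[R]_n) := (fst @^-1` B) `&` ((fun z => z.1 + - z.2) @^-1` A).
have mG : measurable G.
  apply: measurableI; first exact: (measurable_preimageT measurable_fst).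
  exact: (measurable_preimageT measurable_rV_add).
have mG' : measurable G'.
  apply: measurableI; first exact: (measurable_preimageT measurable_fst).
  apply: (@measurable_preimageT _ _ _ _ (fun z : 'rV[R]_n * 'rV[R]_n => z.1 + - z.2)) => //.
  apply: (measurableT_comp measurable_rV_add (g := fun z : 'rV[R]_n * 'rV[R]_n => (z.1, - z.2))).
  apply: measurable_fun_pair; first exact: measurable_fst.
  exact: (measurableT_comp measurable_rV_opp measurable_snd).
have mA' := measurable_preimageT measurable_rV_opp mA.
rewrite -(product_slices (G := G)) //; last first.
  by move=> x xA; apply/seteqP; split => y; rewrite /xsection /= inE => -[].
  move=> x xA; rewrite -(lebesgueV_shift x mB); congr (lam _).
  by apply/seteqP; split => y; rewrite /xsection /= inE /G /= addrC //; case.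
rewrite -(product_slices (G := G')) //; last first.
  by move=> x xA; apply/seteqP; split => y; rewrite /xsection /= inE => -[].
  move=> x xA; rewrite -(lebesgueV_shift (- x) mA'); congr (lam _).
  by apply/seteqP; split => y; rewrite /xsection /= inE /G' /= opprD opprK addrC //; case.
rewrite !product_measure_exchange //; rewrite /product_measure2; apply: eq_integral => y _ /=.
have mG'y : measurable (ysection G' y) by exact: measurable_ysection.
rewrite -[RHS](inv y mG'y); congr (mu _).
apply/seteqP; split => x; rewrite /ysection /= !inE /G /G' /= addrK.
  by case.
by case.
Qed.

End Swap.

(** The case mu = lam of [haar_swap], with the unit cube for B. *)
Lemma lebesgueV_opp A : measurable A -> lam ((fun x => - x) @^-1` A) = lam A.
Proof.
move=> mA; have := haar_swap (mu := lam) (@lebesgueV_shift R n) mA (@measurable_cube R n 0 1).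
by rewrite lebesgueV_cube // subr0 expr1n mule1 mul1e => ->.
Qed.

(** This is [haar_swap] with the unit cube for B; finiteness on cubes makes mu sigma-finite. *)
Lemma haar_unique (mu : {measure set 'rV[R]_n -> \bar R}) :
  (forall k : nat, (mu (cube n (- k%:R) k%:R) < +oo)%E) ->
  (forall t A, measurable A -> mu ((fun x => x + t)%R @^-1` A) = mu A) ->
  forall A, measurable A -> mu A = (mu (cube n 0 1) * lam A)%E.
Proof.
move=> fin inv A mA.
have sf : sigma_finite setT mu.
  exists (fun k => cube n (- k%:R) k%:R) => [|k];
    last by split; [exact: measurable_cube|exact: fin].
  apply/seteqP; split => // x _.
  pose M := \sum_(i < n) `|x ord0 i|.
  exists (Num.truncn M).+1 => // i; rewrite -ler_norml.
  apply: (@le_trans _ _ M); first by rewrite /M (bigD1 i) //= lerDl sumr_ge0.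
  by rewrite ltW // truncnS_gt.
pose H1 := isSFinite.Build _ _ _ _ (sfinite_measure_sigma_finite sf).
pose H2 := isSigmaFinite.Build _ _ _ _ sf.
pose mu' : {sigma_finite_measure set 'rV[R]_n -> \bar R} :=
  HB.pack (Measure.sort mu) H1 H2.
have := haar_swap (mu := mu') inv mA (@measurable_cube R n 0 1).
by rewrite lebesgueV_cube // subr0 expr1n mule1 lebesgueV_opp.
Qed.

End Haar.

(** * Lebesgue measure in orthonormal coordinates *)

Section DotProduct.
Variables (R : realType).

Lemma dotvE n (x y : 'rV[R]_n) : dotv x y = (x *m y^T) ord0 ord0.
Proof. by rewrite mxE; apply: eq_bigr => i _; rewrite mxE. Qed.

Lemma dotvC n (x y : 'rV[R]_n) : dotv x y = dotv y x.
Proof. by apply: eq_bigr => i _; rewrite mulrC. Qed.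

Lemma dotvDl n (x y z : 'rV[R]_n) : dotv (x + y) z = dotv x z + dotv y z.
Proof. by rewrite !dotvE mulmxDl mxE. Qed.

Lemma dotvDr n (x y z : 'rV[R]_n) : dotv z (x + y) = dotv z x + dotv z y.
Proof. by rewrite dotvC dotvDl ![dotv _ z]dotvC. Qed.

Lemma dotvNl n (x z : 'rV[R]_n) : dotv (- x) z = - dotv x z.
Proof. by rewrite !dotvE mulNmx mxE. Qed.

Lemma dotvNr n (x z : 'rV[R]_n) : dotv z (- x) = - dotv z x.
Proof. by rewrite dotvC dotvNl dotvC. Qed.

Lemma dotvBl n (x y z : 'rV[R]_n) : dotv (x - y) z = dotv x z - dotv y z.
Proof. by rewrite dotvDl dotvNl. Qed.

Lemma dotvBr n (x y z : 'rV[R]_n) : dotv z (x - y) = dotv z x - dotv z y.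
Proof. by rewrite dotvDr dotvNr. Qed.

Lemma dotvZl n (a : R) (x z : 'rV[R]_n) : dotv (a *: x) z = a * dotv x z.
Proof. by rewrite !dotvE -scalemxAl mxE. Qed.

Lemma dotvZr n (a : R) (x z : 'rV[R]_n) : dotv z (a *: x) = a * dotv z x.
Proof. by rewrite dotvC dotvZl dotvC. Qed.

Lemma dotv_suml n (I : finType) (P : pred I) (F : I -> 'rV[R]_n) (z : 'rV[R]_n) :
  dotv (\sum_(i | P i) F i) z = \sum_(i | P i) dotv (F i) z.
Proof. by rewrite !dotvE mulmx_suml summxE; apply: eq_bigr => i _; rewrite dotvE. Qed.

Lemma dotv0l n (z : 'rV[R]_n) : dotv 0 z = 0.
Proof. by rewrite dotvE mul0mx mxE. Qed.

Lemma dotv_ge0 n (x : 'rV[R]_n) : 0 <= dotv x x.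
Proof. by apply: sumr_ge0 => i _; rewrite -expr2 sqr_ge0. Qed.

Lemma dotv_eq0 n (x : 'rV[R]_n) : (dotv x x == 0) = (x == 0).
Proof.
apply/eqP/eqP => [h|->]; last by rewrite dotv0l.
apply/rowP => i; rewrite mxE; apply/eqP; rewrite -sqrf_eq0 expr2.
move/eqP: h; rewrite psumr_eq0; last by move=> k _; rewrite -expr2 sqr_ge0.
by move=> /allP /(_ i (mem_index_enum _)).
Qed.

Lemma dotv_mulmx n m (v : 'rV[R]_m) (M : 'M[R]_(m, n)) (x : 'rV[R]_n) :
  dotv (v *m M) x = dotv v (x *m M^T).
Proof. by rewrite !dotvE trmx_mul trmxK mulmxA. Qed.

Lemma eballE n (x : 'rV[R]_n) : (eball 1 : set 'rV[R]_n) x <-> dotv x x <= 1.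
Proof.
rewrite /eball /enorm /=; split => [h|h]; last by rewrite -sqrtr1 ler_wsqrtr.
rewrite -[dotv x x]sqr_sqrtr ?dotv_ge0 //.
by rewrite exprn_ile1 // sqrtr_ge0.
Qed.

Lemma coord_le_dotv n (x : 'rV[R]_n) i : x ord0 i ^+ 2 <= dotv x x.
Proof.
by rewrite /dotv (bigD1 i) //= -expr2 lerDl sumr_ge0 // => k _; rewrite -expr2 sqr_ge0.
Qed.

Lemma eball_sub_cube n : (eball 1 : set 'rV[R]_n) `<=` cube n (- 1) 1.
Proof.
move=> x /eballE h i; rewrite -ler_norml -(@expr_le1 _ 2) // real_normK ?num_real //.
exact: le_trans (coord_le_dotv _ _) h.
Qed.

Lemma cube_sub_eball n : cube n 0 (n.+1%:R^-1) `<=` (eball 1 : set 'rV[R]_n).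
Proof.
move=> x h; apply/eballE.
apply: (@le_trans _ _ (\sum_(i < n) n.+1%:R^-1)).
  apply: ler_sum => i _; have /andP[h0 h1] := h i.
  apply: (@le_trans _ _ (n.+1%:R^-1 * 1)); last by rewrite mulr1.
  apply: ler_pM => //; apply: (le_trans h1); rewrite invf_le1 ?ltr0n // ler1n //.
rewrite sumr_const card_ord -[_ *+ n]mulr_natl ler_pdivrMr ?ltr0n // mul1r ler_nat //.
Qed.

Lemma lebesgueV_eball_fin n : (lebesgueV R n (eball 1) < +oo)%E.
Proof.
apply: le_lt_trans (lebesgueV_cube_fin n (- 1) 1).
apply: le_measure; rewrite ?inE;
  [exact: measurable_eball|exact: measurable_cube|exact: eball_sub_cube].
Qed.

Lemma lebesgueV_eball_gt0 n : (0 < lebesgueV R n (eball 1))%E.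
Proof.
apply: (@lt_le_trans _ _ (lebesgueV R n (cube n 0 (n.+1%:R^-1)))).
  by rewrite lebesgueV_cube ?invr_ge0// subr0 lte_fin exprn_gt0// invr_gt0 ltr0n.
apply: le_measure; rewrite ?inE;
  [exact: measurable_cube|exact: measurable_eball|exact: cube_sub_eball].
Qed.

Lemma kappaE n : lebesgueV R n (eball 1) = (kappa R n)%:E.
Proof. by rewrite fineK // ge0_fin_numE ?lebesgueV_eball_fin // measure_ge0. Qed.

Lemma kappa_gt0 n : 0 < kappa R n.
Proof. by rewrite -lte_fin -kappaE lebesgueV_eball_gt0. Qed.

Lemma measurable_mulmx n m (M : 'M[R]_(m, n)) : measurable_fun setT (fun v : 'rV[R]_m => v *m M).
Proof.
apply: measurable_rVP => i.
rewrite (_ : (fun _ => _) = fun v : 'rV[R]_m => \sum_(l < m) v ord0 l * M l i);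
  last by apply/funext => v; rewrite mxE.
apply: measurable_sum => l; apply: measurable_funM; first exact: measurable_coord.
exact: measurable_cst.
Qed.

Lemma measurable_affine n m (q : 'rV[R]_n) (M : 'M[R]_(m, n)) :
  measurable_fun setT (fun v : 'rV[R]_m => q + v *m M).
Proof.
rewrite (_ : (fun _ => _) = fun v => v *m M + q); last by apply/funext => v; rewrite addrC.
exact: (measurableT_comp (measurable_rV_shift q) (measurable_mulmx M)).
Qed.

Lemma measurable_frame j m n (E : 'M[R]_(j, n)) (F : 'M[R]_(m, n)) :
  measurable_fun setT (fun z : 'rV[R]_j * 'rV[R]_m => z.1 *m E + z.2 *m F).
Proof.
apply: (measurableT_comp (@measurable_rV_add R n)
  (g := fun z : 'rV[R]_j * 'rV[R]_m => (z.1 *m E, z.2 *m F))).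
apply: measurable_fun_pair.
  exact: (measurableT_comp (measurable_mulmx E) measurable_fst).
exact: (measurableT_comp (measurable_mulmx F) measurable_snd).
Qed.

Lemma cube_mulmx n m (M : 'M[R]_(m, n)) K : 0 <= K ->
  exists2 K', 0 <= K' & forall x : 'rV[R]_m, cube m (- K) K x -> cube n (- K') K' (x *m M).
Proof.
move=> K0; exists (\sum_j \sum_l K * `|M l j|).
  by apply: sumr_ge0 => j _; apply: sumr_ge0 => l _; rewrite mulr_ge0.
move=> x h i; rewrite -ler_norml mxE (bigD1 i) //=.
apply: (@le_trans _ _ (\sum_l K * `|M l i|)); last first.
  by rewrite lerDl; apply: sumr_ge0 => j _; apply: sumr_ge0 => l _; rewrite mulr_ge0.
apply: (le_trans (ler_norm_sum _ _ _)); apply: ler_sum => l _.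
by rewrite normrM ler_wpM2r // ler_norml.
Qed.

End DotProduct.

Section Frame.
Variables (R : realType) (j m : nat).
Local Notation lam := (lebesgueV R).

Section Phi.
Variables (E : 'M[R]_(j, j + m)) (F : 'M[R]_(m, j + m)).
Hypotheses (EE : E *m E^T = 1%:M) (FF : F *m F^T = 1%:M) (EF : E *m F^T = 0).

Let phi (z : 'rV[R]_j * 'rV[R]_m) : 'rV[R]_(j + m) := z.1 *m E + z.2 *m F.

Lemma frame_orthC : F *m E^T = 0.
Proof. by apply: trmx_inj; rewrite trmx_mul trmxK EF trmx0. Qed.

Lemma frame_completeness : E^T *m E + F^T *m F = 1%:M.
Proof.
rewrite -mul_row_col; apply: mulmx1C.
by rewrite mul_col_row EE FF EF frame_orthC -scalar_mx_block.
Qed.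

Lemma frame_pythagoras z : dotv (phi z) (phi z) = dotv z.1 z.1 + dotv z.2 z.2.
Proof.
rewrite /phi dotvDl !dotvDr !dotv_mulmx -!mulmxA.
by rewrite EE FF EF frame_orthC !mulmx1 !mulmx0 ![dotv _ 0]dotvC !dotv0l addr0 add0r.
Qed.

(** By uniqueness of invariant measures, the product of the coordinate measures is a
    multiple of Lebesgue measure. *)
Lemma frame_measure_prop A : measurable A ->
  (lam j \x lam m)%E (phi @^-1` A) =
  ((lam j \x lam m)%E (phi @^-1` cube (j + m) 0 1) * lam (j + m) A)%E.
Proof.
move: A; apply: (@haar_unique R (j + m) (pushforward_measure (lam j \x lam m)%E
  (measurable_frame E F))) => [k|t A mA].
  have [K1 K10 h1] := cube_mulmx E^T (ler0n R k).
  have [K2 K20 h2] := cube_mulmx F^T (ler0n R k).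
  apply: (@le_lt_trans _ _ ((lam j \x lam m)%E (cube j (- K1) K1 `*` cube m (- K2) K2))).
    rewrite /= /pushforward; apply: le_measure; rewrite ?inE.
    - by apply: measurable_preimageT; [exact: measurable_frame|exact: measurable_cube].
    - by apply: measurableX; exact: measurable_cube.
    move=> z hz; split => /=.
      rewrite (_ : z.1 = phi z *m E^T); first exact: h1.
      by rewrite mulmxDl -!mulmxA EE frame_orthC mulmx1 mulmx0 addr0.
    rewrite (_ : z.2 = phi z *m F^T); first exact: h2.
    by rewrite mulmxDl -!mulmxA EF FF mulmx1 mulmx0 add0r.
  rewrite [X in (X < _)%E](_ : _ = lam j (cube j (- K1) K1) * lam m (cube m (- K2) K2))%E; last first.
    exact: (product_measure1E (lam j) (lam m)
      (@measurable_cube R j _ _) (@measurable_cube R m _ _)).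
  by rewrite lte_mul_pinfty ?ge0_fin_numE ?lebesgueV_cube_fin.
rewrite /= /pushforward.
rewrite (_ : phi @^-1` _ = (fun z => (z.1 + t *m E^T, z.2 + t *m F^T)) @^-1` (phi @^-1` A)).
  apply: (@product_measure_preserved _ _ _ _ _ (lam j) (lam m)
    (fun x => x + t *m E^T) (fun x => x + t *m F^T)).
  - exact: measurable_rV_shift.
  - exact: measurable_rV_shift.
  - by move=> B mB; exact: lebesgueV_shift.
  - by move=> B mB; exact: lebesgueV_shift.
  by apply: measurable_preimageT => //; exact: measurable_frame.
apply/seteqP; split => z /=; congr A;
  rewrite /phi !mulmxDl /= -!mulmxA addrACA -mulmxDr frame_completeness mulmx1 //.
Qed.

End Phi.

(** The constant of proportionality is read off the unit ball, whose preimage under an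
    orthonormal frame is the same for all frames; for the standard frame the constant is 1,
    as the unit cube shows. *)
Lemma lebesgueV_frame_linear (E : 'M[R]_(j, j + m)) (F : 'M[R]_(m, j + m)) :
  E *m E^T = 1%:M -> F *m F^T = 1%:M -> E *m F^T = 0 -> forall A, measurable A ->
  (lam j \x lam m)%E ((fun z => z.1 *m E + z.2 *m F) @^-1` A) = lam (j + m) A.
Proof.
move=> EE FF EF A mA.
pose E0 : 'M[R]_(j, j + m) := row_mx 1%:M 0.
pose F0 : 'M[R]_(m, j + m) := row_mx 0 1%:M.
have EE0 : E0 *m E0^T = 1%:M by rewrite tr_row_mx mul_row_col trmx1 trmx0 mulmx1 mulmx0 addr0.
have FF0 : F0 *m F0^T = 1%:M by rewrite tr_row_mx mul_row_col trmx1 trmx0 mulmx1 mulmx0 add0r.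
have EF0 : E0 *m F0^T = 0 by rewrite tr_row_mx mul_row_col trmx1 trmx0 mulmx1 mulmx0 addr0.
have mb := measurable_eball (R := R) (d := j + m) 1.
have c0 : (lam j \x lam m)%E ((fun z => z.1 *m E0 + z.2 *m F0) @^-1` cube (j + m) 0 1) = 1%E.
  rewrite (_ : _ @^-1` _ = cube j 0 1 `*` cube m 0 1).
    transitivity (lam j (cube j 0 1) * lam m (cube m 0 1))%E.
      exact: (product_measure1E (lam j) (lam m)
        (@measurable_cube R j _ _) (@measurable_cube R m _ _)).
    by rewrite !lebesgueV_cube // subr0 !expr1n mule1.
  have row0E (z : 'rV[R]_j * 'rV[R]_m) : z.1 *m E0 + z.2 *m F0 = row_mx z.1 z.2.
    by rewrite !mul_mx_row !mulmx1 !mulmx0 add_row_mx addr0 add0r.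
  apply/seteqP; split => z /=; rewrite row0E.
    by move=> h; split => i; [have := h (lshift m i)|have := h (rshift j i)];
      rewrite ?row_mxEl ?row_mxEr.
  by move=> [h1 h2] i; rewrite -(splitK i); case: (fintype.split i) => i' /=;
    rewrite ?row_mxEl ?row_mxEr.
have hb0 := frame_measure_prop EE0 FF0 EF0 mb; rewrite c0 mul1e in hb0.
have hb := frame_measure_prop EE FF EF mb.
have e : (fun z : 'rV[R]_j * 'rV[R]_m => z.1 *m E + z.2 *m F) @^-1` eball 1 =
         (fun z : 'rV[R]_j * 'rV[R]_m => z.1 *m E0 + z.2 *m F0) @^-1` eball 1.
  by apply/seteqP; split => z /= /eballE h; apply/eballE; move: h; rewrite !frame_pythagoras.
rewrite e hb0 in hb.
rewrite frame_measure_prop //.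
set c := product_measure1 _ _ _ in hb *.
suff -> : c = 1%E by rewrite mul1e.
have c_ge0 : (0 <= c)%E by exact: measure_ge0.
move: hb; rewrite kappaE => hb; have k0 := kappa_gt0 R (j + m).
case: c c_ge0 hb => [c | |] //=; last by rewrite gt0_mulye ?lte_fin.
rewrite -EFinM => _ [h]; congr (_%:E); apply/(mulIf (lt0r_neq0 k0)); by rewrite mul1r -h.
Qed.

Lemma lebesgueV_frame d (q : 'rV[R]_d) (E : 'M[R]_(j, d)) (F : 'M[R]_(m, d)) A :
  (j + m)%N = d -> E *m E^T = 1%:M -> F *m F^T = 1%:M -> E *m F^T = 0 -> measurable A ->
  lam d A = (lam j \x lam m)%E ((fun z => q + z.1 *m E + z.2 *m F)%R @^-1` A).
Proof.
move=> e; case: _ / e q E F A => q E F A EE FF EF mA.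
rewrite -(lebesgueV_shift q mA) -(lebesgueV_frame_linear EE FF EF) //.
  congr (product_measure1 _ _ _);
    rewrite (_ : (fun z => q + z.1 *m E + z.2 *m F) = fun z => z.1 *m E + z.2 *m F + q) //.
  by apply/funext => z; rewrite [RHS]addrC addrA.
by apply: measurable_preimageT => //; exact: measurable_rV_shift.
Qed.

End Frame.

Section Scaling.
Variables (R : realType) (n : nat).
Local Notation lam := (lebesgueV R n).

(** A dilation pushes Lebesgue measure forward to a translation-invariant measure. *)
Lemma lebesgueV_scale (r : R) (A : set 'rV[R]_n) : 0 < r -> measurable A ->
  lam ((fun x => r *: x)%R @^-1` A) = ((r ^- n)%:E * lam A)%E.
Proof.
move=> r0 mA.
have ms s : measurable_fun setT (fun x : 'rV[R]_n => s *: x).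
  rewrite (_ : (fun _ => _) = fun x : 'rV[R]_n => x *m s%:M); first exact: measurable_mulmx.
  by apply/funext => x; rewrite mul_mx_scalar.
have := @haar_unique R n (pushforward_measure lam (ms r)).
have rne : r != 0 by rewrite gt_eqF.
have cE a b : (fun x : 'rV[R]_n => r *: x) @^-1` cube n a b = cube n (a / r) (b / r).
  apply/seteqP; split => x /= h i; have := h i;
    rewrite mxE ler_pdivrMr // ler_pdivlMr // [r * _]mulrC //.
move=> H; apply: (eq_trans (H _ _ A mA)); rewrite /=.
- by move=> k; rewrite /pushforward cE lebesgueV_cube_fin.
- move=> t B mB; rewrite /pushforward.
  rewrite -[RHS](lebesgueV_shift (r^-1 *: t)); last exact: measurable_preimageT.
  by congr (lam _); apply/seteqP; split => x /=; rewrite scalerDr scalerA divff // scale1r.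
by rewrite /pushforward cE lebesgueV_cube ?mul0r ?mul1r ?invr_ge0 ?ltW// subr0 exprVn //.
Qed.

End Scaling.

Section Frames.
Variables (R : realType) (d : nat).

Lemma mulmx_tr_dotv n (x y : 'rV[R]_n) : x *m y^T = (dotv x y)%:M.
Proof. by rewrite [LHS]mx11_scalar dotvE. Qed.

Lemma gram_schmidt_step r (E : 'M[R]_(r, d)) (b : 'rV[R]_d) : E *m E^T = 1%:M ->
  exists r', exists E' : 'M[R]_(r', d), E' *m E'^T = 1%:M /\ (E' :=: b + E)%MS.
Proof.
move=> EE; pose b' := b - b *m E^T *m E.
have b'E : (b *m E^T *m E <= E)%MS by exact: submxMl.
have [b0|b0] := eqVneq b' 0.
  exists r, E; split=> //; apply/eqmxP/andP; split; first exact: addsmxSr.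
  by rewrite addsmx_sub submx_refl andbT; move/eqP: b0; rewrite subr_eq0 => /eqP ->.
have n0 : dotv b' b' != 0 by rewrite dotv_eq0.
have nE : enorm b' ^+ 2 = dotv b' b' by rewrite sqr_sqrtr // dotv_ge0.
have n0' : enorm b' != 0 by rewrite -sqrf_eq0 nE.
have bE : b' *m E^T = 0 by rewrite mulmxBl -!mulmxA EE mulmx1 subrr.
have Eb : E *m b'^T = 0 by apply: trmx_inj; rewrite trmx_mul trmxK bE trmx0.
exists (1 + r)%N, (col_mx ((enorm b')^-1 *: b') E); split.
  rewrite tr_col_mx mul_col_row EE linearZ /= -!scalemxAl -!scalemxAr bE Eb !scaler0.
  rewrite mulmx_tr_dotv !scale_scalar_mx mulrA -invfM -expr2 nE mulVf //.
  by rewrite [RHS](@scalar_mx_block _ 1 r).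
apply: eqmx_trans (eqmx_sym (addsmxE _ _)) _.
apply/eqmxP/andP; split; rewrite !addsmx_sub addsmxSr andbT.
  apply: scalemx_sub; rewrite /b'; apply: addmx_sub; first exact: addsmxSl.
  by rewrite eqmx_opp; apply: submx_trans b'E (addsmxSr _ _).
have -> : b = enorm b' *: ((enorm b')^-1 *: b') + b *m E^T *m E.
  by rewrite scalerA mulfV // scale1r subrK.
apply: addmx_sub; first by apply: scalemx_sub; exact: addsmxSl.
exact: submx_trans b'E (addsmxSr _ _).
Qed.

Lemma orthonormal_rank r (E : 'M[R]_(r, d)) : E *m E^T = 1%:M -> \rank E = r.
Proof.
move=> EE; apply/eqP; rewrite -[_ == _]/(row_free E); apply/row_freeP.
by exists E^T.
Qed.

Lemma exists_frame m (A : 'M[R]_(m, d)) :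
  exists E : 'M[R]_(\rank A, d), E *m E^T = 1%:M /\ (E :=: A)%MS.
Proof.
suff [r [E [EE EA]]] : exists r, exists E : 'M[R]_(r, d), E *m E^T = 1%:M /\ (E :=: A)%MS.
  have e : r = \rank A by rewrite -EA orthonormal_rank.
  by case: _ / e; exists E.
elim: m A => [|m IH] A.
  exists 0%N, (0 : 'M[R]_(0, d)); split; first by rewrite [LHS]flatmx0 [RHS]flatmx0.
  by rewrite (flatmx0 A).
have [r [E [EE EA]]] := IH (dsubmx (A : 'M[R]_(1 + m, d))).
have [r' [E' [EE' EA']]] := gram_schmidt_step (usubmx (A : 'M[R]_(1 + m, d))) EE.
have hX (X : 'M[R]_(1 + m, d)) : (usubmx X + dsubmx X :=: X)%MS.
  by rewrite -{3}[X]vsubmxK; exact: addsmxE.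
exists r', E'; split => //; apply: (eqmx_trans EA').
apply: eqmx_trans (hX A); exact: adds_eqmx.
Qed.

Lemma exists_frame_compl j (E : 'M[R]_(j, d)) : E *m E^T = 1%:M ->
  exists F : 'M[R]_(d - j, d), [/\ F *m F^T = 1%:M, E *m F^T = 0 & (F :=: kermx E^T)%MS].
Proof.
move=> EE; have := exists_frame (kermx E^T).
rewrite mxrank_ker mxrank_tr orthonormal_rank // => -[F [FF FK]].
exists F; split => //; apply: trmx_inj; rewrite trmx_mul trmxK trmx0.
by apply/sub_kermxP; rewrite FK.
Qed.

Lemma extend_rank m (A : 'M[R]_(m, d)) i : (\rank A + i <= d)%N ->
  exists B : 'M[R]_d, (A <= B)%MS /\ \rank B = (\rank A + i)%N.
Proof.
elim: i => [|i IH] h; first by exists <<A>>%MS; rewrite addn0 !genmxE.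
have [|B [AB rB]] := IH; first by move: h; rewrite addnS => /ltnW.
have /row_subPn[l hl] : ~~ (1%:M <= B)%MS.
  by rewrite sub1mx /row_full rB; move: h; rewrite addnS; case: ltngtP.
exists (B + row l 1%:M)%MS; split; first exact: submx_trans AB (addsmxSl _ _).
apply/eqP; rewrite eqn_leq; apply/andP; split.
  apply: (leq_trans (mxrank_adds_leqif _ _)); rewrite rB addnS -[(_ + _).+1]addn1 leq_add2l.
  exact: rank_leq_row.
rewrite addnS -rB; apply: rank_ltmx; rewrite ltmxE addsmxSl /=.
by apply: contra hl; apply: submx_trans; exact: addsmxSr.
Qed.

Lemma exists_frame_ge m (A : 'M[R]_(m, d)) k : (\rank A <= k <= d)%N ->
  exists E : 'M[R]_(k, d), E *m E^T = 1%:M /\ (A <= E)%MS.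
Proof.
move=> /andP[h1 h2]; have [|B [AB rB]] := @extend_rank _ A (k - \rank A).
  by rewrite subnKC.
have := exists_frame B; rewrite rB subnKC // => -[E [EE EB]].
by exists E; rewrite EB.
Qed.

End Frames.

Section Flat.
Variables (R : realType) (n : nat).

Lemma origin_cube m : [set 0] = cube m 0 0 :> set 'rV[R]_m.
Proof.
apply/seteqP; split => x /=; first by move=> -> i; rewrite mxE lexx.
by move=> h; apply/rowP => i; rewrite mxE; apply/eqP; rewrite eq_le andbC h.
Qed.

Lemma lebesgueV_origin m : (0 < m)%N -> lebesgueV R m [set 0] = 0%E.
Proof. by move=> m0; rewrite origin_cube lebesgueV_cube // subrr expr0n gtn_eqF. Qed.

Lemma measurable_origin m : measurable ([set 0] : set 'rV[R]_m).
Proof. by rewrite origin_cube; exact: measurable_cube. Qed.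

(** In an orthonormal frame adapted to D the set is contained in a product with a point. *)
Lemma lebesgueV_flat m (D : 'M[R]_(m, n)) (q : 'rV[R]_n) (A : set 'rV[R]_n) :
  measurable A -> (\rank D < n)%N -> (forall x, A x -> (x - q <= D)%MS) ->
  lebesgueV R n A = 0%E.
Proof.
move=> mA rD h; have [E [EE ED]] := exists_frame D.
have [F [FF EF FK]] := exists_frame_compl EE.
rewrite (lebesgueV_frame q (subnKC (ltnW rD)) EE FF EF mA).
apply/eqP; rewrite eq_le measure_ge0 andbT.
have pm0 : (lebesgueV R (\rank D) \x lebesgueV R (n - \rank D))%E (setT `*` [set 0%R]) = 0%E.
  transitivity (lebesgueV R (\rank D) setT * lebesgueV R (n - \rank D) [set 0%R])%E.
    by apply: product_measure1E => //; exact: measurable_origin.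
  by rewrite lebesgueV_origin ?subn_gt0 // mule0.
rewrite -[leRHS]pm0; apply: le_measure; rewrite ?inE.
- apply: measurable_preimageT => //.
  rewrite (_ : (fun _ => _) = fun z => z.1 *m E + z.2 *m F + q); last first.
    by apply/funext => z; rewrite [RHS]addrC addrA.
  exact: (measurableT_comp (measurable_rV_shift q) (measurable_frame E F)).
- by apply: measurableX => //; exact: measurable_origin.
move=> z /= /h; rewrite addrAC [q + _]addrC addrK -ED => /submxP[w hw]; split => //.
have := congr1 (fun M => M *m F^T) hw.
by rewrite mulmxDl -!mulmxA EF FF mulmx1 !mulmx0 add0r.
Qed.

End Flat.

(** * Nearest points of a polytope *)

Section Hull.
Variables (R : realType) (N d : nat) (p : 'I_N -> 'rV[R]_d).
Implicit Types (I J : {set 'I_N}) (x y u : 'rV[R]_d).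

Definition simplex_weights I (c : 'I_N -> R) :=
  (forall i, i \in I -> 0 <= c i) /\ \sum_(i in I) c i = 1.

Lemma convex_comb_in (M : set 'rV[R]_d) I c :
  (forall x y t, 0 <= t -> t <= 1 -> M x -> M y -> M (t *: x + (1 - t) *: y)) ->
  (forall i, i \in I -> M (p i)) -> simplex_weights I c ->
  M (\sum_(i in I) c i *: p i).
Proof.
move=> cM; elim: {I}#|I| {-2}I (erefl #|I|) c => [|n IH] I cI c pM [c0 c1].
  move/cards0_eq: cI c1 => ->; rewrite big_set0 => /esym/eqP.
  by rewrite oner_eq0.
have /card_gt0P[i0 i0I] : (0 < #|I|)%N by rewrite cI.
have cD : #|I :\ i0| = n by have := cardsD1 i0 I; rewrite i0I cI => -[].
rewrite (big_setD1 i0) //=; rewrite (big_setD1 i0) //= in c1.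
set s := \sum_(i in I :\ i0) c i in c1.
have subI i : i \in I :\ i0 -> i \in I by rewrite in_setD1 => /andP[].
have s0 : 0 <= s by apply: sumr_ge0 => i /subI /c0.
have [se|sne] := eqVneq s 0.
  have c01 : c i0 = 1 by rewrite -c1 se addr0.
  rewrite c01 scale1r big1 ?addr0; first exact: pM.
  move=> i iI; suff -> : c i = 0 by rewrite scale0r.
  by apply/eqP; move/eqP: se; rewrite psumr_eq0 =>
    [/allP/(_ i (mem_index_enum _))/implyP/(_ iI)|j /subI/c0].
have -> : \sum_(i in I :\ i0) c i *: p i = (1 - c i0) *: \sum_(i in I :\ i0) (c i / s) *: p i.
  rewrite -c1 addrAC subrr add0r scaler_sumr; apply: eq_bigr => i _.
  by rewrite scalerA mulrCA divff // mulr1.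
apply: cM; [exact: c0| by rewrite -c1 lerDl| exact: pM|].
apply: (IH _ cD (fun i => c i / s)) => [i /subI|]; first exact: pM.
split=> [i /subI/c0 h|]; first by rewrite divr_ge0.
by rewrite -mulr_suml divff.
Qed.

Lemma points_hullP I x : points_hull p I x <->
  exists2 c, simplex_weights I c & x = \sum_(i in I) c i *: p i.
Proof.
split=> [|[c wc ->]].
  move: x; apply: (@smallest_sub _ _ _
    [set x | exists2 c, simplex_weights I c & x = \sum_(i in I) c i *: p i]).
    move=> y z t; rewrite !inE => -[c [c0 c1] ->] [e [e0 e1] ->].
    exists (fun i => t%:num * c i + (1 - t%:num) * e i).
      have t0 : 0 <= t%:num by [].
      have t1 : 0 <= 1 - t%:num by rewrite subr_ge0.
      split=> [i iI|]; first by rewrite addr_ge0 // mulr_ge0 ?c0 ?e0.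
      by rewrite big_split /= -!mulr_sumr c1 e1 !mulr1 addrC subrK.
    rewrite /conv /= !scaler_sumr -big_split /=; apply: eq_bigr => i _.
    by rewrite !scalerA -scalerDl.
  move=> _ [i iI <-]; exists (fun j => (j == i)%:R).
    split=> [j _|]; first by rewrite ler0n.
    rewrite (bigD1 i) //= eqxx big1 ?addr0 // => j /andP[_ /negbTE ->] //.
  rewrite (bigD1 i) //= eqxx scale1r big1 ?addr0 // => j /andP[_ /negbTE ->].
  by rewrite scale0r.
move=> M [cM pM]; apply: convex_comb_in => //.
  move=> y z t t0 t1 yM zM; apply/set_mem.
  by have := cM y z (Itv01 t0 t1); apply; exact: mem_set.
by move=> i iI; apply: pM; exists i.
Qed.

Lemma points_hull_sub I J : J \subset I -> points_hull p J `<=` points_hull p I.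
Proof.
move=> JI x hx M [cM pM]; apply: hx; split => // _ [i iJ <-]; apply: pM.
by exists i => //; exact: (fintype.subsetP JI).
Qed.

Lemma mem_points_hull I i : i \in I -> points_hull p I (p i).
Proof. by move=> iI M [_ pM]; apply: pM; exists i. Qed.

(** For nonempty J, the relatively open cone of the u for which the linear form (dotv _ u)
    attains its maximum over the points p_i, i in I, exactly at J. *)
Definition ncone I J : set 'rV[R]_d :=
  [set u | (forall i j, i \in J -> j \in J -> dotv (p i) u = dotv (p j) u) /\
           (forall i j, i \in I :\: J -> j \in J -> dotv (p i) u < dotv (p j) u)].

Lemma dotv_comb I c u : dotv (\sum_(i in I) c i *: p i) u = \sum_(i in I) c i * dotv (p i) u.
Proof. by rewrite dotv_suml; apply: eq_bigr => i _; rewrite dotvZl. Qed.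

Lemma hull_dotv_le I x u (b : R) : points_hull p I x ->
  (forall i, i \in I -> dotv (p i) u <= b) -> dotv x u <= b.
Proof.
move=> /points_hullP[c [c0 c1] ->] h; rewrite dotv_comb -[b]mul1r -c1 mulr_suml.
by apply: ler_sum => i iI; rewrite ler_wpM2l ?c0 ?h.
Qed.

Lemma hull_dotv_ge I x u (b : R) : points_hull p I x ->
  (forall i, i \in I -> b <= dotv (p i) u) -> b <= dotv x u.
Proof.
move=> hx h; rewrite -lerN2 -dotvNr; apply: hull_dotv_le hx _ => i iI.
by rewrite dotvNr lerN2 h.
Qed.

Lemma hull_neq0 I x : points_hull p I x -> I != finset.set0.
Proof.
move=> /points_hullP[c [_ c1] _]; apply: contraPneq c1 => ->.
by rewrite big_set0 => /esym/eqP; rewrite oner_eq0.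
Qed.

Lemma ncone_hull I J j y u : J \subset I -> j \in J -> points_hull p J y -> ncone I J u ->
  dotv y u = dotv (p j) u.
Proof.
move=> JI jJ hy [h1 h2]; apply/eqP; rewrite eq_le; apply/andP; split.
  by apply: hull_dotv_le hy _ => i iJ; rewrite (h1 i j).
by apply: hull_dotv_ge hy _ => i iJ; rewrite (h1 i j).
Qed.

Lemma ncone_max I J i y u : J \subset I -> points_hull p J y -> ncone I J u ->
  i \in I -> dotv (p i) u <= dotv y u.
Proof.
move=> JI hy hu iI; have /set0Pn[j jJ] := hull_neq0 hy.
rewrite (ncone_hull JI jJ hy hu); have [h1 h2] := hu.
have [iJ|iJ] := boolP (i \in J); first by rewrite (h1 i j).
by apply/ltW/h2; rewrite // inE iJ.
Qed.

Lemma ncone_maxE I J i y u : J \subset I -> points_hull p J y -> ncone I J u ->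
  i \in I -> (i \in J) = (dotv (p i) u == dotv y u).
Proof.
move=> JI hy hu iI; have /set0Pn[j jJ] := hull_neq0 hy.
rewrite (ncone_hull JI jJ hy hu); have [h1 h2] := hu.
have [iJ|iJ] := boolP (i \in J); first by rewrite (h1 i j) ?eqxx.
by apply/esym/negbTE; rewrite lt_eqF // h2 // inE iJ.
Qed.

(** If y + u = y' + u', adding the two maximality inequalities shows that
    |y' - y|^2 = dotv (u - u') (y' - y) is nonpositive. *)
Lemma normal_decomposition_unique I J J' y y' u u' :
  J \subset I -> J' \subset I -> points_hull p J y -> points_hull p J' y' ->
  ncone I J u -> ncone I J' u' -> y + u = y' + u' -> J = J' /\ y = y'.
Proof.
move=> JI JI' hy hy' hu hu' e.
have a1 : dotv y' u <= dotv y u.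
  by apply: (hull_dotv_le (points_hull_sub JI' hy')) => i iI; exact: ncone_max hu iI.
have a2 : dotv y u' <= dotv y' u'.
  by apply: (hull_dotv_le (points_hull_sub JI hy)) => i iI; exact: ncone_max hu' iI.
have uu : u - u' = y' - y by apply/eqP; rewrite subr_eq addrAC -e addrAC subrr add0r.
have yy : y = y'.
  apply/esym/eqP; rewrite -subr_eq0 -dotv_eq0.
  rewrite eq_le dotv_ge0 andbT -{2}uu dotvBr !dotvBl; move: a1 a2; lra.
split => //; rewrite -yy in hy'.
have {}uu : u = u' by apply/eqP; rewrite -subr_eq0 uu -yy subrr.
rewrite -uu in hu'; apply/finset.setP => i.
have [iI|iI] := boolP (i \in I).
  by rewrite (ncone_maxE JI hy hu iI) (ncone_maxE JI' hy' hu' iI).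
by rewrite (contraNF (fintype.subsetP JI i) iI) (contraNF (fintype.subsetP JI' i) iI).
Qed.

(** The vector u is the shortest one from the polytope to y + u. *)
Lemma normal_decomposition_dist I J y u r : 0 <= r -> J \subset I -> points_hull p J y -> ncone
  I J u ->
  [set x + z | x in points_hull p I & z in (eball r : set 'rV[R]_d)] (y + u) <->
  (eball r : set 'rV[R]_d) u.
Proof.
move=> r0 JI hy hu; split => [[x hx [z hz e]]|hr];
  last by exists y; [exact: points_hull_sub hy|exists u].
have a1 : dotv x u <= dotv y u.
  by apply: (hull_dotv_le hx) => i iI; exact: ncone_max hu iI.
rewrite /eball /=; apply: le_trans hz; rewrite /enorm ler_sqrt ?dotv_ge0 //.
have -> : z = u + (y - x) by rewrite addrCA addrA -e [x + z]addrC addrK.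
have wu : dotv (y - x) u = dotv y u - dotv x u by rewrite dotvBl.
have := dotv_ge0 (y - x); move: (y - x) wu => w wu.
rewrite dotvDl !dotvDr [dotv u w]dotvC wu; move: a1; lra.
Qed.

End Hull.

Section Nearest.
Variables (R : realType) (N d : nat) (p : 'I_N -> 'rV[R]_d).
Implicit Types (I J : {set 'I_N}) (x y u : 'rV[R]_d).

Lemma dotv_subZ (u w : 'rV[R]_d) t :
  dotv (u - t *: w) (u - t *: w) = dotv u u - 2 * t * dotv w u + t * (t * dotv w w).
Proof. by rewrite !(dotvBr, dotvBl, dotvZl, dotvZr) [dotv u w]dotvC; ring. Qed.

Lemma coord_sum_continuous (M : 'I_N -> R) I :
  continuous (fun c : 'rV[R]_N => \sum_(i in I) c ord0 i * M i : R).
Proof.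
apply: (@continuous_big _ _ _ _ _ _ _ _ (fun i (c : 'rV[R]_N) => c ord0 i * M i)) => [|i _ c].
  exact: add_continuous.
by apply: continuousM; [exact: coord_continuous|exact: cst_continuous].
Qed.

(** The nearest point exists because the simplex of weights is compact. *)
Lemma nearest_weights I x : I != finset.set0 ->
  exists2 c : 'I_N -> R, simplex_weights I c &
    forall e, simplex_weights I e ->
      dotv (x - \sum_(i in I) c i *: p i) (x - \sum_(i in I) c i *: p i) <=
      dotv (x - \sum_(i in I) e i *: p i) (x - \sum_(i in I) e i *: p i).
Proof.
move=> /set0Pn[i0 i0I].
pose D : set 'rV[R]_N := [set v : 'rV[R]_N | forall i, `[(0:R), 1] (v ord0 i)] `&`
  (fun v : 'rV[R]_N => \sum_(i in I) v ord0 i * 1) @^-1` [set 1].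
have cD : compact D.
  apply: compact_closedI.
    exact: (@rV_compact R N (fun=> `[(0:R), 1]) (fun=> @segment_compact R 0 1)).
  apply: preimage_closed; last exact: closed_eq.
  by move=> c _; apply: (@coord_sum_continuous (fun=> 1) I c).
have D0 : D !=set0.
  exists (\row_i (i == i0)%:R); split => [i|] /=.
    by rewrite mxE in_itv /= ler0n lern1 leq_b1.
  rewrite (bigD1 i0) //= mxE eqxx mulr1 big1 ?addr0 // => j /andP[_ /negbTE h].
  by rewrite mxE h mul0r.
pose f (c : 'rV[R]_N) : R := \sum_(l < d) (x ord0 l - \sum_(i in I) c ord0 i * p i ord0 l) *
  (x ord0 l - \sum_(i in I) c ord0 i * p i ord0 l).
have cf : continuous f.
  pose g l (c : 'rV[R]_N) : R := x ord0 l - \sum_(i in I) c ord0 i * p i ord0 l.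
  have cg l : continuous (g l).
    move=> c; apply: (@continuousB R R _ (fun=> x ord0 l)); first exact: cst_continuous.
    by apply: (@coord_sum_continuous (fun i => p i ord0 l) I c).
  apply: (@continuous_big _ _ _ _ _ _ _ _ (fun l c => g l c * g l c)) => [|l _ c].
    exact: add_continuous.
  exact: (continuousM (@cg l c) (@cg l c)).
have fE (c : 'rV[R]_N) (e : 'I_N -> R) : (forall i, i \in I -> c ord0 i = e i) ->
   f c = dotv (x - \sum_(i in I) e i *: p i) (x - \sum_(i in I) e i *: p i).
  move=> h; apply: eq_bigr => l _; rewrite !mxE summxE.
  by congr (_ * _); congr (_ - _); apply: eq_bigr => i iI; rewrite mxE h.
have [c cD1 cmin] := compact_EVT_min D0 cD (continuous_subspaceT cf).
have {cD1} [c01 c1] := set_mem cD1.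
exists (fun i => c ord0 i).
  split => [i _|]; first by have := c01 i; rewrite /= in_itv /= => /andP[].
  by rewrite -[RHS]c1; apply: eq_bigr => i _; rewrite mulr1.
move=> e [e0 e1]; rewrite -(fE c (fun i => c ord0 i)) //.
rewrite -(fE (\row_i if i \in I then e i else 0)); last by move=> i iI; rewrite mxE iI.
apply: cmin; apply: mem_set; split => [i|] /=.
  rewrite in_itv /= mxE; case: ifPn => iI; last by rewrite lexx ler01.
  rewrite e0 //= -e1 (bigD1 i) //= lerDl; apply: sumr_ge0 => j /andP[jI _]; exact: e0.
by rewrite -[RHS]e1; apply: eq_bigr => i iI; rewrite mxE iI mulr1.
Qed.

(** Moving from the nearest point y towards p_i cannot bring it closer to x; to first
    order this says that y maximises the form given by x - y. *)
Lemma normal_decomposition I x : I != finset.set0 ->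
  exists J y, [/\ J \subset I, points_hull p J y & ncone p I J (x - y)].
Proof.
move=> I0; have [c wc cmin] := nearest_weights x I0; have [c0 c1] := wc.
set y := \sum_(i in I) c i *: p i in cmin; pose u := x - y.
have var i : i \in I -> dotv (p i) u <= dotv y u.
  move=> iI; rewrite leNgt; apply/negP; rewrite -subr_gt0 -dotvBl => a0.
  set w := p i - y in a0; set a := dotv w u in a0; pose b := dotv w w.
  have b0 : 0 <= b by exact: dotv_ge0.
  have ab0 : 0 < a + b by rewrite ltr_pwDl.
  (* The step t lies in [0, 1], and it changes the squared distance to x by
     - 2 * t * a + t ^ 2 * b = - t * a - t ^ 2 * a. *)
  pose t := a / (a + b).
  have t0 : 0 <= t by rewrite divr_ge0 // ltW.
  have t1 : 0 <= 1 - t by rewrite subr_ge0 ler_pdivrMr // mul1r lerDl.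
  have := cmin (fun j => (1 - t) * c j + t * (j == i)%:R).
  have -> : \sum_(j in I) ((1 - t) * c j + t * (j == i)%:R) *: p j = y + t *: w.
    transitivity ((1 - t) *: y + t *: p i).
      rewrite /y scaler_sumr (bigD1 i) //= [in RHS](bigD1 i) //= eqxx mulr1 scalerDl scalerA
        addrAC; congr (_ + _ + _).
      by apply: eq_bigr => j /andP[_ /negbTE ->]; rewrite mulr0 addr0 scalerA.
    by rewrite /w scalerBr scalerBl scale1r addrAC addrA.
  have -> : x - (y + t *: w) = u - t *: w by rewrite /u opprD addrA.
  case/(_ _)/Wrap => [|].
    split => [j jI|]; first by rewrite addr_ge0 // mulr_ge0 ?c0 ?ler0n.
    rewrite big_split /= -!mulr_sumr c1 (bigD1 i) //= eqxx big1 ?addr0 ?mulr1 ?subrK //.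
    by move=> j /andP[_ /negbTE ->].
  rewrite -/u dotv_subZ -/a -/b.
  have tab : t * (a + b) = a by rewrite /t divfK // gt_eqF.
  have t0' : 0 < t by rewrite divr_gt0.
  have tb : t * b = a - t * a by move: tab; rewrite mulrDr; lra.
  have ta : 0 < t * a by rewrite mulr_gt0.
  have tta : 0 <= t * (t * a) by rewrite mulr_ge0 // ltW.
  rewrite tb mulrBr; move: ta tta; lra.
pose J := [set i in I | dotv (p i) u == dotv y u]%SET.
have JI : J \subset I by apply/fintype.subsetP => i; rewrite inE => /andP[].
have cJ i : i \in I :\: J -> c i = 0.
  move=> iIJ; have iI : i \in I by move: iIJ; rewrite inE => /andP[].
  have : \sum_(i in I) c i * (dotv y u - dotv (p i) u) = 0.
    under eq_bigr do rewrite mulrBr.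
    by rewrite sumrB -mulr_suml c1 mul1r /y dotv_comb subrr.
  move/eqP; rewrite psumr_eq0; last by move=> j jI; rewrite mulr_ge0 ?c0 ?subr_ge0 ?var.
  move/allP/(_ i (mem_index_enum _))/implyP/(_ iI); rewrite mulf_eq0 => /orP[/eqP//|].
  by rewrite subr_eq0 eq_sym => h; move: iIJ; rewrite !inE iI h.
have yJ : y = \sum_(i in J) c i *: p i.
  rewrite /y (big_setID J) /= (finset.setIidPr JI) [X in _ + X]big1 ?addr0 // => i iIJ.
  by rewrite cJ ?scale0r.
exists J, y; split => //.
  apply/points_hullP; exists c => //; split => [i /(fintype.subsetP JI)/c0//|].
  by rewrite -c1 [RHS](big_setID J) /= (finset.setIidPr JI) [X in _ + X]big1 ?addr0.
split => [i j|i j]; rewrite !inE.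
  by move=> /andP[_ /eqP ->] /andP[_ /eqP ->].
move=> /andP[h iI] /andP[_ /eqP ->]; rewrite lt_neqAle var // andbT.
by move: h; rewrite iI.
Qed.

End Nearest.

Section Measurability.
Variables (R : realType) (N d : nat) (p : 'I_N -> 'rV[R]_d).
Implicit Types (I J : {set 'I_N}) (x y u : 'rV[R]_d).

Lemma measurable_dotv u : measurable_fun setT (fun x : 'rV[R]_d => dotv x u : measurableTypeR R).
Proof.
apply: measurable_sum => i; apply: measurable_funM; first exact: measurable_coord.
exact: measurable_cst.
Qed.

Lemma measurable_halfspace u (a : R) : measurable [set x | dotv x u <= a].
Proof.
have := measurable_preimageT (measurable_dotv u) (measurable_itv (`]-oo, a])%R).
by congr measurable; apply/seteqP; split => x /=; rewrite in_itv.
Qed.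

Lemma measurable_openhalfspace u (a : R) : measurable [set x | dotv x u < a].
Proof.
have := measurable_preimageT (measurable_dotv u) (measurable_itv (`]-oo, a[)%R).
by congr measurable; apply/seteqP; split => x /=; rewrite in_itv.
Qed.

Lemma rat_approx u (e : R) : 0 < e ->
  exists q : 'rV[rat]_d, forall l, `|(map_mx ratr q - u) ord0 l| < e.
Proof.
move=> e0.
have /fin_all_exists [q hq] : forall l, exists r : rat, `|ratr r - u ord0 l| < e.
  move=> l; have /rat_in_itvoo[r] : u ord0 l - e < u ord0 l + e by rewrite ltrD2l gtrN.
  by rewrite in_itv /= => h; exists r; rewrite ltr_distl.
by exists (\row_l q l) => l; rewrite !mxE.
Qed.

(** A compact convex set is the intersection of the half-spaces containing it; by density
    those with rational normal vectors suffice, and there are countably many of them. *)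
Lemma hull_halfspaces I : I != finset.set0 -> points_hull p I =
  \bigcap_(q in [set: 'rV[rat]_d])
    \bigcup_(i in [set` I]) [set x | dotv x (map_mx ratr q) <= dotv (p i) (map_mx ratr q)].
Proof.
move=> I0; apply/seteqP; split => [x hx q _|x hx].
  apply: contrapT => h; have /points_hullP[c wc xE] := hx.
  suff : dotv x (map_mx ratr q) < dotv x (map_mx ratr q) by rewrite ltxx.
  have lt i : i \in I -> dotv (p i) (map_mx ratr q) < dotv x (map_mx ratr q).
    by move=> iI; rewrite ltNge; apply/negP => le; apply: h; exists i.
  have [c0 c1] := wc.
  rewrite {1}xE dotv_comb -[ltRHS]mul1r -c1 mulr_suml -subr_gt0 -sumrB.
  have [i iI ci] : exists2 i, i \in I & 0 < c i.
    apply: contrapT => hc; move: c1; rewrite big1 => [/esym/eqP|i iI]; first by rewrite oner_eq0.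
    by apply/eqP; rewrite eq_le c0 // andbT leNgt; apply/negP => ci; apply: hc; exists i.
  rewrite (bigD1 i) //= ltr_pwDl //; first by rewrite -mulrBr mulr_gt0 // subr_gt0 lt.
  by apply: sumr_ge0 => j /andP[jI _]; rewrite -mulrBr mulr_ge0 ?c0 // subr_ge0 ltW // lt.
apply: contrapT => hnx.
have [J [y [JI hy hu]]] := normal_decomposition p x I0.
set u := x - y in hu.
have u0 : 0 < dotv u u.
  rewrite lt_neqAle dotv_ge0 andbT eq_sym dotv_eq0 subr_eq0.
  by apply/eqP => xy; apply: hnx; rewrite xy; exact: points_hull_sub hy.
pose M := \sum_i \sum_l `|(x - p i) ord0 l|.
have M0 : 0 <= M by apply: sumr_ge0 => i _; apply: sumr_ge0.
have e0 : 0 < dotv u u / (M + 1) by rewrite divr_gt0 // ltr_wpDl.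
have [q hq] := rat_approx u e0.
have [i iI /=] := hx q Logic.I.
rewrite -subr_le0 -dotvBl => h.
have h1 : dotv u u <= dotv (x - p i) u.
  rewrite -subr_ge0 -dotvBl (_ : x - p i - u = y - p i); last first.
    by rewrite /u opprB addrC addrA subrK.
  by rewrite dotvBl subr_ge0; exact: ncone_max hu iI.
have h2 : - dotv (x - p i) (map_mx ratr q - u) <= M * (dotv u u / (M + 1)).
  rewrite -dotvNl; apply: (@le_trans _ _ (\sum_l `|(x - p i) ord0 l| * (dotv u u / (M + 1)))).
    apply: ler_sum => l _; apply: (le_trans (ler_norm _)); rewrite normrM.
    by apply: ler_pM => //; [rewrite mxE normrN|exact: ltW].
  rewrite -mulr_suml ler_wpM2r // ?(ltW e0) //.
  by rewrite /M (bigD1 i) //= lerDl; apply: sumr_ge0 => j _; apply: sumr_ge0.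
have h3 : M * (dotv u u / (M + 1)) < dotv u u.
  by rewrite mulrCA gtr_pMr // ltr_pdivrMr ?mul1r ?ltrDl ?ltr_wpDl.
have : 0 < dotv (x - p i) (map_mx ratr q).
  move: h2 h3; rewrite dotvBr => h2 h3.
  have := le_lt_trans h2 h3; rewrite opprB ltrBlDr => /(le_lt_trans h1).
  by rewrite ltrDl.
by rewrite ltNge h.
Qed.

Lemma measurable_hull I : I != finset.set0 -> measurable (points_hull p I).
Proof.
move=> I0; rewrite hull_halfspaces //.
rewrite -[X in measurable X]setCK setC_bigcap; apply: measurableC.
rewrite bigcup_mkcond; apply: countable_bigcupT_measurable; first exact: countableP.
move=> q; rewrite mem_set //; apply: measurableC.
by apply: fin_bigcup_measurable => // i _; exact: measurable_halfspace.
Qed.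

Lemma measurable_ncone I J : measurable (ncone p I J).
Proof.
rewrite (_ : ncone p I J =
  (\bigcap_(ij in [set z : 'I_N * 'I_N | z.1 \in J /\ z.2 \in J])
     [set x | dotv x (p ij.1 - p ij.2) <= 0]) `&`
  (\bigcap_(ij in [set z : 'I_N * 'I_N | z.1 \in I :\: J /\ z.2 \in J])
     [set x | dotv x (p ij.1 - p ij.2) < 0])).
  by apply: measurableI; apply: fin_bigcap_measurable => // ij _;
    [exact: measurable_halfspace|exact: measurable_openhalfspace].
apply/seteqP; split => [u [h1 h2]|u [h1 h2]].
  split => -[i j] /= []; first by move=> iJ jJ; rewrite dotvBr subr_le0 ![dotv u _]dotvC (h1 i j).
  by move=> iJ jJ; rewrite dotvBr subr_lt0 ![dotv u _]dotvC (h2 i j).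
split => i j iJ jJ.
  apply/eqP; rewrite eq_le -subr_le0 -[X in _ && X]subr_le0 -!dotvBl ![dotv _ u]dotvC.
  by apply/andP; split; [apply: (h1 (i, j))|apply: (h1 (j, i))].
by rewrite -subr_lt0 -dotvBl dotvC; apply: (h2 (i, j)).
Qed.

End Measurability.

(** * Affine dimension and adapted frames *)

Section Directions.
Variables (R : realType) (N d : nat) (p : 'I_N -> 'rV[R]_d).
Implicit Types (S I J : {set 'I_N}) (x y u : 'rV[R]_d).

Definition basepoint S : 'rV[R]_d := if [pick i in S] is Some i then p i else 0.

(** The row space is the direction of the affine span of the points in S, so the rank is
    their affine dimension. *)
Definition dirmx S : 'M[R]_(N, d) := \matrix_i (if i \in S then p i - basepoint S else 0).

Lemma baseP S : S != finset.set0 -> exists2 i, i \in S & basepoint S = p i.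
Proof.
move=> /set0Pn[i iS]; rewrite /basepoint; case: pickP => [j jS|/(_ i)]; first by exists j.
by rewrite iS.
Qed.

Lemma row_dirmx S i : i \in S -> row i (dirmx S) = p i - basepoint S.
Proof. by move=> iS; rewrite rowK iS. Qed.

Lemma dirmx_base S i : i \in S -> (p i - basepoint S <= dirmx S)%MS.
Proof. by move=> iS; rewrite -row_dirmx // row_sub. Qed.

Lemma dirmx_diff S i j : i \in S -> j \in S -> (p i - p j <= dirmx S)%MS.
Proof.
move=> iS jS; rewrite -(subrK (basepoint S) (p i)) -addrA; apply: addmx_sub;
  first exact: dirmx_base.
by rewrite -opprB eqmx_opp; exact: dirmx_base.
Qed.

Lemma dirmx_sub S m (E : 'M[R]_(m, d)) :
  (forall i j, i \in S -> j \in S -> (p i - p j <= E)%MS) -> (dirmx S <= E)%MS.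
Proof.
move=> h; apply/row_subP => i; rewrite rowK; case: ifPn => [iS|_]; last exact: sub0mx.
by have [|j jS ->] := @baseP S; [apply/set0Pn; exists i|exact: h].
Qed.

Lemma dirmx_subset S S' : S \subset S' -> (dirmx S <= dirmx S')%MS.
Proof. by move=> /fintype.subsetP h; apply: dirmx_sub => i j /h iS /h jS; exact: dirmx_diff. Qed.

Lemma comb_base S c : \sum_(i in S) c i = 1 ->
  \sum_(i in S) c i *: p i = basepoint S + \sum_(i in S) c i *: (p i - basepoint S).
Proof.
move=> c1; rewrite -{1}[basepoint S]scale1r -c1 scaler_suml -big_split /=; apply: eq_bigr => i _.
by rewrite scalerBr addrC subrK.
Qed.

Lemma comb_dirmx S c : \sum_(i in S) c i = 1 ->
  (\sum_(i in S) c i *: p i - basepoint S <= dirmx S)%MS.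
Proof.
move=> c1; rewrite comb_base // addrAC subrr add0r; apply: summx_sub => i iS.
by apply: scalemx_sub; exact: dirmx_base.
Qed.

Lemma hull_dirmx S x : points_hull p S x -> (x - basepoint S <= dirmx S)%MS.
Proof. by move=> /points_hullP[c [_ c1] ->]; exact: comb_dirmx. Qed.

Lemma rank_sum_rows n (A : {set 'I_N}) (F : 'I_N -> 'rV[R]_n) :
  (\rank (\sum_(i in A) <<F i>>)%MS <= #|A|)%N.
Proof.
rewrite -sum1_card.
elim/big_ind2: _ => [|m1 A1 m2 A2 h1 h2|i _]; first by rewrite mxrank0.
  by apply: (leq_trans (mxrank_adds_leqif _ _)); exact: leq_add.
by rewrite genmxE; exact: rank_leq_row.
Qed.

Lemma rank_dirmx_lt S : S != finset.set0 -> (\rank (dirmx S) < #|S|)%N.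
Proof.
move=> S0; have [i0 iS0 b0] := baseP S0.
apply: (@leq_ltn_trans #|S :\ i0|); last by rewrite [ltnRHS](cardsD1 i0) iS0.
have h : (dirmx S <= \sum_(i in S :\ i0) <<p i - basepoint S>>)%MS.
  apply/row_subP => i; rewrite rowK; case: ifPn => [iS|_]; last exact: sub0mx.
  have [->|ii0] := eqVneq i i0; first by rewrite b0 subrr sub0mx.
  by apply: (sumsmx_sup i); rewrite ?inE ?ii0 // genmxE.
exact: (leq_trans (mxrankS h) (rank_sum_rows _ _)).
Qed.

(** The left kernel of the matrix of directions consists of the affine dependencies, up to
    the coordinates outside S and the one at the base point. *)
Lemma aff_indep_rank S : S != finset.set0 -> aff_indep p S -> (#|S|.-1 <= \rank (dirmx S))%N.
Proof.
move=> S0 hS; have [i0 iS0 b0] := baseP S0.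
have cS : #|S|.-1 = #|S :\ i0| by rewrite (cardsD1 i0) iS0.
rewrite cS; have subS i : i \in S :\ i0 -> i \in S by rewrite in_setD1 => /andP[].
have h : (kermx (dirmx S) <= \sum_(i in ~: (S :\ i0)) <<(delta_mx ord0 i : 'rV[R]_N)>>)%MS.
  apply/row_subP => l; set v : 'rV[R]_N := row l _.
  have : v *m dirmx S = 0 by rewrite /v -row_mul mulmx_ker row0.
  rewrite mulmx_sum_row => v0.
  pose s := \sum_(j in S :\ i0) v ord0 j.
  pose c i := if i == i0 then - s else v ord0 i.
  have cE i : i \in S :\ i0 -> c i = v ord0 i by rewrite in_setD1 /c => /andP[/negbTE ->].
  have c0 : \sum_(i in S) c i = 0.
    by rewrite (big_setD1 i0) //= (eq_bigr _ cE) /c eqxx addNr.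
  have cp : \sum_(i in S) c i *: p i = 0.
    rewrite (big_setD1 i0) //= {1}/c eqxx scaleNr scaler_suml -sumrN -big_split /= -[RHS]v0.
    rewrite [RHS](bigID (mem (S :\ i0))) /= [X in _ = _ + X]big1 => [|i]; last first.
      rewrite in_setD1 negb_and negbK => /orP[/eqP ->|iS].
        by rewrite row_dirmx // b0 subrr scaler0.
      by rewrite rowK (negbTE iS) scaler0.
    rewrite addr0; apply: eq_bigr => i iS; rewrite cE // row_dirmx ?subS // b0.
    by rewrite scalerBr addrC.
  have vS i : i \in S :\ i0 -> v ord0 i = 0.
    by move=> iS; rewrite -cE // (hS _ c0 cp) // subS.
  rewrite (matrix_sum_delta v) big_ord1; apply: summx_sub => i _.
  have [/vS ->|iS] := boolP (i \in S :\ i0); first by rewrite scale0r sub0mx.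
  by apply: scalemx_sub; apply: (sumsmx_sup i); rewrite ?inE ?genmxE // -in_setD1.
have := leq_trans (mxrankS h) (rank_sum_rows _ _).
rewrite mxrank_ker => h'.
have := cardsC (S :\ i0); rewrite card_ord => cC.
by have := rank_leq_row (dirmx S); lia.
Qed.

Lemma exists_card_subset (J : {set 'I_N}) m : (m <= #|J|)%N ->
  exists2 S : {set 'I_N}, S \subset J & #|S| = m.
Proof.
move=> h; have /set0Pn[S] : [set S : {set 'I_N} | S \subset J & #|S| == m]%SET != finset.set0.
  by rewrite -card_gt0 cards_draws bin_gt0.
by rewrite inE => /andP[SJ /eqP cS]; exists S.
Qed.

(** Fewer points have a smaller dimension, and among k + 2 or more points there are k + 2
    independent ones. *)
Lemma rank_dirmx_card J k : (forall S : {set 'I_N}, #|S| = k.+2 -> aff_indep p S) ->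
  J != finset.set0 -> \rank (dirmx J) = k -> #|J| = k.+1.
Proof.
move=> hp J0 rJ; apply/eqP; rewrite eqn_leq -{2}rJ rank_dirmx_lt // andbT leqNgt; apply/negP => h.
have [S SJ cS] := exists_card_subset h.
have S0 : S != finset.set0 by rewrite -card_gt0 cS.
have := leq_trans (aff_indep_rank S0 (hp S cS)) (mxrankS (dirmx_subset SJ)).
by rewrite cS rJ ltnn.
Qed.

End Directions.

Section ChosenFrames.
Variables (R : realType) (N d : nat) (p : 'I_N -> 'rV[R]_d).
Implicit Types (S I J : {set 'I_N}) (x y u : 'rV[R]_d).

(** The coordinates chosen in the definition of kvol exist as soon as the points span at most k
    dimensions. *)
Lemma kvol_frame S k : S != finset.set0 -> (\rank (dirmx p S) <= k <= d)%N ->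
  exists q, exists E : 'M[R]_(k, d), [/\ E *m E^T = 1%:M,
    points_hull p S `<=` range (fun v => q + v *m E) &
    kvol k (points_hull p S) = fine (lebesgueV R k [set v | points_hull p S (q + v *m E)])].
Proof.
move=> S0 hk; rewrite /kvol; set Q := (X in xget _ X).
have : exists qE, Q qE.
  have [E [EE DE]] := exists_frame_ge hk.
  exists (basepoint p S, E); split => //= x /hull_dirmx/submx_trans/(_ DE)/submxP[w hw].
  by exists w => //; rewrite -hw addrC subrK.
by move=> /(xgetPex (0, 0)); case: (xget _ _) => q E [EE hE]; exists q, E.
Qed.

Lemma hull_frame_sub S k (q : 'rV[R]_d) (E : 'M[R]_(k, d)) :
  points_hull p S `<=` range (fun v => q + v *m E) -> (dirmx p S <= E)%MS.
Proof.
move=> h; apply: dirmx_sub => i j iS jS.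
have [v _ <-] := h _ (mem_points_hull iS); have [w _ <-] := h _ (mem_points_hull jS).
by rewrite opprD addrACA subrr add0r -mulmxBl submxMl.
Qed.

Lemma perp_sphereE S u : S != finset.set0 ->
  perp_sphere p S u <-> enorm u = 1 /\ u *m (dirmx p S)^T = 0.
Proof.
move=> S0; split=> -[u1 hu]; split => //.
  have [i0 iS0 b0] := baseP p S0.
  have span i : i \in S -> aff_span p S (p i).
    move=> iS; exists (fun j => (j == i)%:R) => /=.
      by rewrite (bigD1 i) //= eqxx big1 ?addr0 // => j /andP[_ /negbTE ->].
    rewrite (bigD1 i) //= eqxx scale1r big1 ?addr0 // => j /andP[_ /negbTE ->].
    by rewrite scale0r.
  apply/rowP => i; rewrite [RHS]mxE mxE.
  have [iS|iS] := boolP (i \in S); last first.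
    by apply: big1 => l _; rewrite !mxE (negbTE iS) mxE mulr0.
  apply: etrans (hu (p i) (p i0) (span i iS) (span i0 iS0)).
  by apply: eq_bigr => l _; rewrite !mxE iS b0 !mxE.
move=> _ _ [c c1 <-] [e e1 <-].
have : (\sum_(i in S) c i *: p i - \sum_(i in S) e i *: p i <= dirmx p S)%MS.
  rewrite -(subrK (basepoint p S) (\sum_(i in S) c i *: p i)) -addrA; apply: addmx_sub;
    first exact: comb_dirmx.
  by rewrite -opprB eqmx_opp; exact: comb_dirmx.
move=> /submxP[w ->]; rewrite dotvC dotv_mulmx dotvC dotvE.
by rewrite hu mul0mx mxE.
Qed.

Lemma enorm_frame m (F : 'M[R]_(m, d)) v : F *m F^T = 1%:M -> enorm (v *m F) = enorm v.
Proof. by move=> FF; rewrite /enorm dotv_mulmx -mulmxA FF mulmx1. Qed.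

Lemma perp_frameP S j : S != finset.set0 -> \rank (dirmx p S) = j ->
  let F := perp_frame (d - j) p S in
  F *m F^T = 1%:M /\ F *m (dirmx p S)^T = 0.
Proof.
move=> S0 rS /=.
have [E [EE ED]] := exists_frame (dirmx p S); rewrite rS in E EE ED.
have [F0 [FF0 EF0 FK0]] := exists_frame_compl EE.
have DE0 u : u *m (dirmx p S)^T = 0 <-> u *m E^T = 0.
  have /submxP[W1 hW1] : (dirmx p S <= E)%MS by rewrite ED.
  have /submxP[W2 hW2] : (E <= dirmx p S)%MS by rewrite ED.
  split => h; first by rewrite hW2 trmx_mul mulmxA h mul0mx.
  by rewrite hW1 trmx_mul mulmxA h mul0mx.
rewrite /perp_frame; set Q := (X in xget _ X).
have : exists F, Q F.
  exists F0; split => //; apply/seteqP;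
    split => [_ [v /= v1 <-]|u /(perp_sphereE _ S0)[u1 /DE0 u0]].
    apply/(perp_sphereE _ S0); rewrite enorm_frame //; split => //.
    have /sub_kermxP FE : (F0 <= kermx E^T)%MS by rewrite FK0.
    by apply/DE0; rewrite -mulmxA FE mulmx0.
  have /submxP[w wE] : (u <= F0)%MS by rewrite FK0; apply/sub_kermxP.
  exists w; last by rewrite wE.
  by rewrite /usphere /= -u1 wE enorm_frame.
move=> /(xgetPex 0); move: (xget _ _) => F [FF hF].
split => //; apply/row_matrixP => l; rewrite row0 row_mul.
have : perp_sphere p S (delta_mx ord0 l *m F).
  rewrite -hF; exists (delta_mx ord0 l) => //=.
  rewrite /usphere /= /enorm /dotv (bigD1 l) //= mxE !eqxx mulr1 big1 ?addr0 ?sqrtr1 // =>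
    i /negbTE il.
  by rewrite mxE il andbF mulr0.
by move=> /(perp_sphereE _ S0)[_]; rewrite -rowE.
Qed.

Lemma frame_complete j m (E : 'M[R]_(j, d)) (F : 'M[R]_(m, d)) :
  (j + m)%N = d -> E *m E^T = 1%:M -> F *m F^T = 1%:M -> E *m F^T = 0 ->
  E^T *m E + F^T *m F = 1%:M.
Proof. by move=> e; case: _ / e in E F *; exact: frame_completeness. Qed.

(** When j is the affine dimension of J, the frame that computes kvol and the frame of
    the perpendicular sphere complete each other to an orthonormal basis. *)
Lemma chosen_frames J j : J != finset.set0 -> \rank (dirmx p J) = j ->
  let F := perp_frame (d - j) p J in
  exists q, exists E : 'M[R]_(j, d),
  [/\ E *m E^T = 1%:M, F *m F^T = 1%:M /\ E *m F^T = 0,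
    points_hull p J `<=` range (fun v => q + v *m E), (E :=: dirmx p J)%MS &
    kvol j (points_hull p J) = fine (lebesgueV R j [set v | points_hull p J (q + v *m E)])].
Proof.
move=> J0 rJ F; have jd : (j <= d)%N by rewrite -rJ rank_leq_col.
have [|q [E [EE hE kE]]] := @kvol_frame J j J0; first by rewrite rJ leqnn.
have DE := hull_frame_sub hE.
have [FF FD] := perp_frameP J0 rJ.
have ED : (E :=: dirmx p J)%MS.
  by apply/eqmx_sym/eqmxP; rewrite -mxrank_leqif_eq // rJ orthonormal_rank.
exists q, E; split => //; split => //.
have /submxP[W hW] : (E <= dirmx p J)%MS by rewrite ED.
by apply: trmx_inj; rewrite trmx_mul trmxK trmx0 hW trmx_mul mulmxA FD mul0mx.
Qed.

End ChosenFrames.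

(** * Steiner's formula *)

(** The cone of outer normals at J, cut by a ball, in the coordinates used for the
    spherical integral. *)
Definition cone_cap (R : realType) (N d : nat) (p : 'I_N -> 'rV[R]_d) k
    (I J : {set 'I_N}) (r : R) : set 'rV[R]_(d - k) :=
  [set w | ncone p I J (w *m perp_frame (d - k) p J) /\ eball r w].
Arguments cone_cap {R N d} p k I J r _.

(** Not normalised: the usual external angle at J is the quotient by kappa R (d - k). *)
Definition ext_angle (R : realType) (N d : nat) (p : 'I_N -> 'rV[R]_d) k
    (I J : {set 'I_N}) : R := fine (lebesgueV R (d - k) (cone_cap p k I J 1)).

Definition normal_piece (R : realType) (N d : nat) (p : 'I_N -> 'rV[R]_d)
    (I J : {set 'I_N}) (r : R) : set 'rV[R]_d :=
  [set y + u | y in points_hull p J & u in ncone p I J `&` eball r].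
Arguments normal_piece {R N d} p I J r _.

Section Steiner.
Variables (R : realType) (N d : nat) (p : 'I_N -> 'rV[R]_d).
Implicit Types (S I J : {set 'I_N}) (x y u : 'rV[R]_d).
Local Notation lam := (lebesgueV R).

Lemma measurable_cone_cap k I J r : measurable (cone_cap p k I J r).
Proof.
apply: measurableI; last exact: measurable_eball.
exact: (measurable_preimageT (measurable_mulmx _) (measurable_ncone p I J)).
Qed.

Lemma ncone_scale I J (a : R) u : 0 < a -> ncone p I J (a *: u) <-> ncone p I J u.
Proof.
move=> a0; split=> -[h1 h2]; split => i j iJ jJ.
- by have := h1 i j iJ jJ; rewrite !dotvZr; apply: mulfI; rewrite gt_eqF.
- by have := h2 i j iJ jJ; rewrite !dotvZr ltr_pM2l.
- by rewrite !dotvZr (h1 i j).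
- by rewrite !dotvZr ltr_pM2l // h2.
Qed.

Lemma enormZ n (a : R) (w : 'rV[R]_n) : 0 <= a -> enorm (a *: w) = a * enorm w.
Proof.
move=> a0; rewrite /enorm dotvZl dotvZr mulrA -expr2 sqrtrM ?sqr_ge0 //.
by rewrite sqrtr_sqr ger0_norm.
Qed.

Lemma enorm_eq0 n (w : 'rV[R]_n) : enorm w <= 0 -> w = 0.
Proof.
move=> h; apply/eqP; rewrite -dotv_eq0 eq_le dotv_ge0 andbT.
by rewrite -sqrtr_eq0 eq_le h sqrtr_ge0.
Qed.

Lemma cone_cap_fin k I J : (lam (d - k) (cone_cap p k I J 1) < +oo)%E.
Proof.
apply: le_lt_trans (lebesgueV_eball_fin R (d - k)).
apply: le_measure; rewrite ?inE; [exact: measurable_cone_cap|exact: measurable_eball|].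
by move=> w [].
Qed.

(** For r = 0 the cap lies in the origin, which is negligible unless d = k, and in that
    case the whole space is a point. *)
Lemma cone_cap_scale k I J r : 0 <= r ->
  lam (d - k) (cone_cap p k I J r) = (r ^+ (d - k) * ext_angle p k I J)%:E.
Proof.
move=> r0; rewrite EFinM fineK; last first.
  by rewrite ge0_fin_numE ?cone_cap_fin.
have [rz|rn0] := eqVneq r 0; last first.
  have rp : 0 < r by rewrite lt_neqAle eq_sym rn0.
  have rp' : 0 < r^-1 by rewrite invr_gt0.
  rewrite (_ : cone_cap p k I J r = (fun w => r^-1 *: w) @^-1` cone_cap p k I J 1).
    by rewrite lebesgueV_scale // ?exprVn ?invrK //; exact: measurable_cone_cap.
  apply/seteqP; split => w; rewrite /cone_cap /eball /=
    -scalemxAl (enormZ _ (ltW rp')) mulrC ler_pdivrMr // mul1r.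
    by move=> [h ?]; split => //; apply/ncone_scale.
  by move=> [/(ncone_scale _ _ _ rp') h ?].
rewrite rz; have [dk|dk] := posnP (d - k)%N.
  rewrite [in _ ^+ _]dk expr0 mul1e; congr (lam _ _).
  have w0 (w : 'rV[R]_(d - k)) : w = 0 by apply/rowP => -[i hi]; exfalso; rewrite dk in hi.
  have e0 (w : 'rV[R]_(d - k)) : enorm w = 0 by rewrite (w0 w) /enorm dotv0l sqrtr0.
  by apply/seteqP; split => w; rewrite /cone_cap /eball /= e0 lexx ler01.
rewrite expr0n gtn_eqF // mul0e; apply/eqP; rewrite eq_le measure_ge0 andbT.
rewrite -(lebesgueV_origin R dk); apply: le_measure; rewrite ?inE.
- exact: measurable_cone_cap.
- exact: measurable_origin.
by move=> w [_ /enorm_eq0].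
Qed.

Lemma ncone_perp I J u : ncone p I J u -> u *m (dirmx p J)^T = 0.
Proof.
move=> [h1 _]; apply/rowP => i; rewrite [RHS]mxE mxE.
have [iJ|iJ] := boolP (i \in J); last first.
  by apply: big1 => l _; rewrite !mxE (negbTE iJ) mxE mulr0.
have [i0 iJ0 b0] : exists2 i0, i0 \in J & basepoint p J = p i0.
  by apply: baseP; apply/set0Pn; exists i.
transitivity (dotv (p i - p i0) u); last by rewrite dotvBl (h1 i i0) ?subrr.
by rewrite dotvC; apply: eq_bigr => l _; rewrite !mxE iJ b0 !mxE.
Qed.

Lemma hull_preimage_fin J k (q : 'rV[R]_d) (E : 'M[R]_(k, d)) : E *m E^T = 1%:M ->
  (lam k [set v | points_hull p J (q + v *m E)%R] < +oo)%E.
Proof.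
move=> EE; have [->|J0] := eqVneq J finset.set0.
  rewrite (_ : [set v | _] = set0) ?measure0 ?ltry //.
  by apply/seteqP; split => // v /= /hull_neq0; rewrite eqxx.
pose M := \sum_(i in J) \sum_l `|((p i - q) *m E^T) ord0 l|.
apply: le_lt_trans (lebesgueV_cube_fin k (- M) M).
apply: le_measure; rewrite ?inE.
- apply: measurable_preimageT; [exact: measurable_affine|exact: measurable_hull].
- exact: measurable_cube.
move=> v /= /points_hullP[c [c0 c1] hv] l.
have -> : v = \sum_(i in J) c i *: ((p i - q) *m E^T).
  have -> : v = (q + v *m E - q) *m E^T by rewrite addrAC subrr add0r -mulmxA EE mulmx1.
  rewrite hv -[X in _ - X]scale1r -c1 scaler_suml -sumrB mulmx_suml.
  by apply: eq_bigr => i _; rewrite -scalerBr scalemxAl.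
rewrite -ler_norml summxE (le_trans (ler_norm_sum _ _ _)) //.
apply: ler_sum => i iJ; rewrite mxE normrM.
have ci1 : `|c i| <= 1.
  rewrite ger0_norm ?c0 // -c1 (bigD1 i) //= lerDl; apply: sumr_ge0 => j /andP[jJ _]; exact: c0.
apply: (le_trans (ler_wpM2r _ ci1)) => //; rewrite mul1r (bigD1 l) //= lerDl.
by apply: sumr_ge0.
Qed.

(** The piece is a product in the orthonormal coordinates adapted to J, since normal vectors
    at J are orthogonal to the directions of J. *)
Lemma piece_volume I J (j : nat) (r : R) :
  J != finset.set0 -> \rank (dirmx p J) = j -> 0 <= r ->
  measurable (normal_piece p I J r) /\
  lam d (normal_piece p I J r) = 
    (kvol j (points_hull p J) * ext_angle p j I J * r ^+ (d - j))%:E.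
Proof.
move=> J0 rJ r0.
have [q [E [EE [FF EF] hE ED kE]]] := chosen_frames J0 rJ.
set F := perp_frame (d - j) p J in FF EF *.
have jd : (j <= d)%N by rewrite -rJ rank_leq_col.
have FE : F *m E^T = 0 by apply: trmx_inj; rewrite trmx_mul trmxK EF trmx0.
have compl := frame_complete (subnKC jd) EE FF EF.
pose B1 : set 'rV[R]_j := [set v | points_hull p J (q + v *m E)].
have mB1 : measurable B1.
  apply: measurable_preimageT; [exact: measurable_affine|exact: measurable_hull].
have mB2 := @measurable_cone_cap j I J r.
pose phi (z : 'rV[R]_j * 'rV[R]_(d - j)) := q + z.1 *m E + z.2 *m F.
pose psi (x : 'rV[R]_d) := ((x - q) *m E^T, (x - q) *m F^T).
have psiK z : psi (phi z) = z.
  rewrite /psi /phi addrAC [q + _]addrC addrK !mulmxDl -!mulmxA EE EF FF FE.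
  by rewrite !mulmx1 !mulmx0 addr0 add0r; case: z.
have phiK x : phi (psi x) = x.
  by rewrite /psi /phi /= -addrA -!mulmxA -mulmxDr compl mulmx1 addrC subrK.
have mpsi : measurable_fun setT psi.
  apply: measurable_fun_pair.
    exact: (measurableT_comp (measurable_mulmx E^T) (measurable_rV_shift (- q))).
  exact: (measurableT_comp (measurable_mulmx F^T) (measurable_rV_shift (- q))).
have pieceE : normal_piece p I J r = psi @^-1` (B1 `*` cone_cap p j I J r).
  apply/seteqP; split => x.
    move=> [y hy [u [hu ur] <-]].
    have [v _ vE] := hE _ hy.
    have uE : u *m E^T = 0.
      have /submxP[W ->] : (E <= dirmx p J)%MS by rewrite ED.
      by rewrite trmx_mul mulmxA (ncone_perp hu) mul0mx.
    have uF : u *m F^T *m F = u.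
      by rewrite -mulmxA -[F^T *m F](addKr (E^T *m E)) compl mulmxDr mulmx1 mulmxN mulmxA uE
        mul0mx oppr0 add0r.
    have -> : y + u = phi (v, u *m F^T) by rewrite /phi /= vE uF.
    change ((B1 `*` cone_cap p j I J r) (psi (phi (v, u *m F^T)))).
    rewrite psiK; split; rewrite /= /B1 /= ?vE // /cone_cap /= uF; split => //.
    by rewrite /eball /= -(enorm_frame _ FF) uF.
  move=> [/= h1 [h2 h3]].
  exists (q + (psi x).1 *m E) => //; exists ((psi x).2 *m F); last exact: phiK.
  by split => //; rewrite /eball /= enorm_frame.
have mpiece : measurable (normal_piece p I J r).
  by rewrite pieceE; apply: measurable_preimageT => //; exact: measurableX.
split => //; rewrite (lebesgueV_frame q (subnKC jd) EE FF EF mpiece).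
rewrite (_ : _ @^-1` _ = B1 `*` cone_cap p j I J r); last first.
  rewrite pieceE -comp_preimage (_ : psi \o _ = id) //; apply/funext => z /=; exact: psiK.
transitivity (lam j B1 * lam (d - j) (cone_cap p j I J r))%E.
  exact: product_measure1E.
rewrite cone_cap_scale // kE -mulrA [ext_angle p _ _ _ * _]mulrC.
rewrite [RHS]EFinM [X in _ = (X * _)%E]fineK //.
by rewrite ge0_fin_numE ?hull_preimage_fin.
Qed.

End Steiner.

Section SteinerFormula.
Variables (R : realType) (N d : nat) (p : 'I_N -> 'rV[R]_d).
Implicit Types (S I J : {set 'I_N}) (x y u : 'rV[R]_d).
Local Notation lam := (lebesgueV R).

Local Notation face I := [pred J : {set 'I_N} | (J \subset I) && (J != finset.set0)].

Lemma parallel_body_pieces I r : I != finset.set0 -> 0 <= r ->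
  [set x + y | x in points_hull p I & y in (eball r : set 'rV[R]_d)] =
  \bigcup_(J in [set` enum (face I)]) normal_piece p I J r.
Proof.
move=> I0 r0; apply/seteqP; split => x.
  have [J [y [JI hy hu]]] := normal_decomposition p x I0.
  move=> hx; exists J; first by rewrite /= mem_enum inE JI (hull_neq0 hy).
  exists y => //; exists (x - y); last by rewrite addrC subrK.
  split => //; apply/(normal_decomposition_dist r0 JI hy hu).
  by rewrite addrC subrK.
move=> [J]; rewrite /= mem_enum inE => /andP[JI _] [y hy [u [hu ur] <-]].
by apply/(normal_decomposition_dist r0 JI hy hu).
Qed.

Lemma steiner_formula I r : I != finset.set0 -> 0 <= r ->
  lam d [set (x + y)%R | x in points_hull p I & y in (eball r : set 'rV[R]_d)] =
  (\sum_(J in face I) kvol (\rank (dirmx p J)) (points_hull p J) *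
     ext_angle p (\rank (dirmx p J)) I J * r ^+ (d - \rank (dirmx p J)))%:E.
Proof.
move=> I0 r0; rewrite parallel_body_pieces // measure_fin_bigcup //.
- rewrite -fsbig_seq ?enum_uniq //= big_enum /= -sumEFin; apply: eq_bigr => J.
  by rewrite inE => /andP[JI J0]; have [_ ->] := @piece_volume R N d p I J _ r J0 erefl r0.
- move=> J J'; rewrite /= !mem_enum !inE => /andP[JI _] /andP[JI' _].
  move=> [x [[y hy [u [hu _] xE]] [y' hy' [u' [hu' _] xE']]]].
  have [] := @normal_decomposition_unique _ _ _ p I J J' y y' u u' => //.
  by rewrite xE xE'.
- move=> J; rewrite /= mem_enum inE => /andP[JI J0].
  by have [] := @piece_volume R N d p I J _ r J0 erefl r0.
Qed.

(** A polynomial with infinitely many roots vanishes. *)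
Lemma poly_coef_eq n (a b : nat -> R) :
  (forall r : R, 0 <= r -> \sum_(j < n.+1) a j * r ^+ (n - j) =
    \sum_(j < n.+1) b j * r ^+ (n - j)) ->
  forall j, (j <= n)%N -> a j = b j.
Proof.
move=> h j jn; pose P := \poly_(i < n.+1) (a (n - i)%N - b (n - i)%N).
have P0 r : 0 <= r -> P.[r] = 0.
  move=> r0; rewrite horner_poly (reindex_inj rev_ord_inj) /=.
  transitivity (\sum_(j < n.+1) a j * r ^+ (n - j) - \sum_(j < n.+1) b j * r ^+ (n - j)).
    rewrite -sumrB; apply: eq_bigr => i _; rewrite subSS subKn ?mulrBl //.
    by rewrite -ltnS.
  by rewrite h // subrr.
have PE : P = 0.
  apply/eqP; apply: contraT => Pn0.
  have := @max_poly_roots _ P [seq k%:R | k <- iota 0 (size P)] Pn0.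
  rewrite size_map size_iota ltnn => -> //.
    by apply/allP => _ /mapP[k _ ->]; apply/eqP/P0.
  rewrite map_inj_uniq ?iota_uniq // => m1 m2 /eqP.
  by rewrite eqr_nat => /eqP.
have := congr1 (fun Q : {poly R} => Q`_(n - j)) PE.
rewrite coef0 coef_poly ltnS leq_subr subKn // => /eqP.
by rewrite subr_eq0 => /eqP.
Qed.

(** Grouping the pieces by dimension exhibits coefficients in Steiner's formula, and these are
    unique because every kappa R n is positive. *)
Lemma intrinsic_volume_hull I k : I != finset.set0 -> (k <= d)%N ->
  intrinsic_volume k (points_hull p I) =
  (\sum_(J in face I | \rank (dirmx p J) == k)
     kvol k (points_hull p J) * ext_angle p k I J) / kappa R (d - k).
Proof.
move=> I0 kd; pose V (j : nat) : R := (\sum_(J in face I | \rank (dirmx p J) == j)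
     kvol j (points_hull p J) * ext_angle p j I J) / kappa R (d - j).
rewrite /intrinsic_volume; set Q := (X in xget _ X).
have VQ : Q V.
  split=> [j dj|r r0].
    rewrite /V big1 ?mul0r // => J /andP[_ /eqP rJ].
    by have := rank_leq_col (dirmx p J); rewrite rJ leqNgt dj.
  rewrite steiner_formula //; congr (_%:E).
  rewrite (partition_big (fun J => inord (\rank (dirmx p J)) : 'I_d.+1) xpredT) //=.
  apply: eq_bigr => j _; rewrite /V [kappa _ _ * _]mulrC divfK ?(gt_eqF (kappa_gt0 _ _)) //.
  rewrite mulr_suml; apply: eq_big => J.
    by rewrite -val_eqE /= inordK // ltnS rank_leq_col.
  by move=> /andP[_ /eqP <-]; rewrite inordK ?ltnS ?rank_leq_col.
have [_ hV] := VQ; have [_] := xgetI (fun=> 0) VQ; move: (xget _ Q) => W hW.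
have kW := poly_coef_eq (n := d) 
  (a := fun j => kappa R (d - j) * W j) (b := fun j => kappa R (d - j) * V j).
apply: (mulfI (lt0r_neq0 (kappa_gt0 R (d - k)))); apply: kW => // r r0.
by have := hW r r0; rewrite hV // => -[].
Qed.

End SteinerFormula.

(** * External angles as spherical integrals *)

Section CoefficientN.
Variables (R : realType) (N d : nat) (p : 'I_N -> 'rV[R]_d).
Implicit Types (f g : fba 'I_N) (S I J : {set 'I_N}) (u : 'rV[R]_d).

Lemma big_setUI (T : finType) (A B : {set T}) (F : T -> int) :
  \sum_(i in A :|: B) F i = \sum_(i in A) F i + \sum_(i in B) F i - \sum_(i in A :&: B) F i.
Proof.
have e1 : (A :|: B) :&: A = A by apply/finset.setP => x; rewrite !inE;
  case: (x \in A); rewrite ?andbF ?orbT.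
have e2 : (A :|: B) :\: A = B :\: A by apply/finset.setP => x; rewrite !inE; case: (x \in A).
rewrite (big_setID A) /= e1 e2 [X in _ = _ + X - _](big_setID A) /= [B :&: A]finset.setIC.
by rewrite addrA [X in X - _]addrAC addrK.
Qed.

Lemma ncoefU f g S u : ncoef (f :|: g) S p u =
  ncoef f S p u + ncoef g S p u - ncoef (f :&: g) S p u.
Proof.
rewrite /ncoef bsubstU.
have -> : bsubst (subst_arg p S u) (f :&: g) =
  bsubst (subst_arg p S u) f :&: bsubst (subst_arg p S u) g.
  by apply/finset.setP => a; rewrite !(in_bsubst, inE).
by rewrite !red_eulerE big_setUI mulrBr mulrDr.
Qed.

Lemma ncoef0 S u : ncoef finset.set0 S p u = 0.
Proof.
rewrite /ncoef red_eulerE (_ : bsubst _ _ = finset.set0) ?big_set0 ?mulr0 //.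
by apply/finset.setP => a; rewrite in_bsubst !inE.
Qed.

Lemma card_subset_type S : #|{: {i : 'I_N | i \in S}}| = #|S|.
Proof. by rewrite card_sig; apply: eq_card. Qed.

Lemma set0_neqT S : S != finset.set0 ->
  (finset.set0 : {set {i : 'I_N | i \in S}}) != [set: {i | i \in S}]%SET.
Proof.
move=> S0; rewrite -cards_eq0 in S0; apply/eqP => h; case/negP: S0.
by rewrite -card_subset_type -cardsT -h cards0.
Qed.

Lemma red_euler_setT S : S != finset.set0 ->
  red_euler ([set: {set {i : 'I_N | i \in S}}]%SET) = 0.
Proof.
move=> S0; rewrite red_eulerE.
under eq_bigr do rewrite exprS mulN1r.
rewrite sumrN; apply/eqP; rewrite oppr_eq0; apply/eqP.
have := alternating_sub (finset.set0 : {set {i : 'I_N | i \in S}}).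
rewrite (negbTE (set0_neqT S0)) => h; rewrite -[RHS]h.
by apply: eq_bigl => I; rewrite inE finset.sub0set.
Qed.

Lemma ncoefT S u : S != finset.set0 -> ncoef [set: {set 'I_N}]%SET S p u = 0.
Proof.
move=> S0; rewrite /ncoef (_ : bsubst _ _ = [set: {set {i | i \in S}}]%SET).
  by rewrite red_euler_setT // mulr0.
by apply/finset.setP => a; rewrite in_bsubst !inE.
Qed.

Lemma head_mem S (j i0 : 'I_N) : i0 \in S -> head j (enum S) \in S.
Proof.
move=> iS; rewrite -mem_enum; have : i0 \in enum S by rewrite mem_enum.
by case: (enum S) => //= a s _; rewrite inE eqxx.
Qed.

(** If some y_j with j in I equals X then f(y) = X, whose reduced Euler characteristic is 0.
    Otherwise f(y) is the union of the generators in both S and I, and among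
    such unions only that of all the generators has a nonzero reduced Euler characteristic. *)
Lemma ncoef_uI I S u : S != finset.set0 -> ncoef (uI I) S p u =
  ((S \subset I) && [forall j in I :\: S, dotv (p j - p (head j (enum S))) u < 0])%:R.
Proof.
move=> S0; rewrite /ncoef; set y := subst_arg p S u.
have inB a : (a \in bsubst y (uI I)) = [exists i in I, a \in y i].
  rewrite in_bsubst in_uI; apply/subsetPn/exists_inP => -[i iI h]; exists i => //.
    by move: h; rewrite inE negbK.
  by rewrite inE negbK.
have yS i : i \notin S -> 
    y i = if dotv (p i - p (head i (enum S))) u < 0 then finset.set0 else [set: {set {i | i \in
      S}}]%SET.
  by move=> iS; rewrite /y /subst_arg insubN.
case: (boolP [forall j in I :\: S, _]) => [/forall_inP h|].
  rewrite andbT; pose J' := [set i : {i | i \in S} | val i \in I]%SET.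
  have inB' a : (a \in bsubst y (uI I)) = ~~ (J' \subset a).
    rewrite inB; apply/exists_inP/subsetPn => [[i iI ia]|[i]].
      have [iS|iS] := boolP (i \in S).
        move: ia; rewrite /y /subst_arg insubT inE => ia.
        by exists (Sub i iS) => //; rewrite inE.
      by move: ia; rewrite yS // h ?inE ?iS.
    rewrite inE => iI ia; exists (val i) => //.
    by rewrite /y /subst_arg valK inE.
  have JT : (J' == [set: {i | i \in S}]%SET) = (S \subset I).
    apply/eqP/fintype.subsetP => [h' i iS|h'].
      have : Sub i iS \in J' by rewrite h' inE.
      by rewrite inE.
    by apply/finset.setP => -[i iS]; rewrite !inE /=; exact: h'.
  rewrite red_eulerE (eq_bigl _ _ inB').
  under eq_bigr do rewrite exprS mulN1r.
  have h0 : \sum_(a : {set {i : 'I_N | i \in S}}) (-1) ^+ #|a| = 0 :> int.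
    have := alternating_sub (finset.set0 : {set {i : 'I_N | i \in S}}).
    rewrite (negbTE (set0_neqT S0)) => h0; rewrite -[RHS]h0.
    by apply: eq_bigl => a; rewrite finset.sub0set.
  move/eqP: h0; 
  rewrite (bigID (fun a : {set {i : 'I_N | i \in S}} => J' \subset a)) /= alternating_sub JT.
  rewrite addr_eq0 sumrN => /eqP <-.
  have [SI|SI] := ifP; last by rewrite mulr0.
  have -> : #|J'| = #|S|.
    by move/eqP: JT; rewrite SI => /eqP/eqP ->; rewrite cardsT card_subset_type.
  by rewrite -exprD addnn -signr_odd odd_double.
rewrite negb_forall_in => /exists_inP[j]; rewrite inE => /andP[jS jI] hj.
rewrite andbF (_ : bsubst _ _ = [set: {set {i | i \in S}}]%SET).
  by rewrite red_euler_setT // mulr0.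
apply/finset.setP => a; rewrite inB inE; apply/exists_inP; exists j => //.
by rewrite yS // (negbTE hj) inE.
Qed.

Definition negative_points (M : 'rV[R]_d) S : {set 'I_N} :=
  [set j | dotv (p j - p (head j (enum S))) M < 0].

Lemma ncoef_negative_points f S u u' : negative_points u S =
  negative_points u' S -> ncoef f S p u = ncoef f S p u'.
Proof.
move=> h; rewrite /ncoef; congr (_ * red_euler _).
apply/finset.setP => a; rewrite !in_bsubst; congr (_ \in f); apply/finset.setP => j; rewrite !inE.
congr (~~ (_ \in _)); rewrite /subst_arg; case: insub => // .
by have := congr1 (fun A : {set 'I_N} => j \in A) h; rewrite /= !inE => ->.
Qed.

Lemma measurable_negative_points m (M : 'M[R]_(m, d)) S B :
  measurable [set v : 'rV[R]_m | negative_points (v *m M) S = B].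
Proof.
pose D j := [set v : 'rV[R]_m | dotv v ((p j - p (head j (enum S))) *m M^T) < 0].
rewrite (_ : [set v | _] = \bigcap_(j in [set: 'I_N]) (if j \in B then D j else ~` D j)).
  apply: fin_bigcap_measurable => // j _.
  by case: ifP => _; [|apply: measurableC]; exact: measurable_openhalfspace.
have e v j : (j \in negative_points (v *m M) S) =
  (dotv v ((p j - p (head j (enum S))) *m M^T) < 0).
  by rewrite inE dotvC dotv_mulmx.
apply/seteqP; split => v /=.
  by move=> <- j _; rewrite e /D; case: ifP => //= ->.
move=> h; apply/finset.setP => j; rewrite e; have := h j Logic.I.
by case: ifP => _; rewrite /D /= => // /negP/negbTE.
Qed.

(** The integrand only depends on which of finitely many linear forms are negative. *)
Lemma measurable_ncoef f m (M : 'M[R]_(m, d)) S :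
  measurable_fun setT (fun v : 'rV[R]_m => (ncoef f S p (v *m M))%:~R : measurableTypeR R).
Proof.
pose G B : R := if pselect (exists v : 'rV[R]_m, negative_points (v *m M) S = B) is left h
  then (ncoef f S p (projT1 (cid h) *m M))%:~R else 0.
rewrite (_ : (fun _ => _) = fun v =>
  \sum_(B : {set 'I_N}) G B * \1_[set v : 'rV[R]_m | negative_points (v *m M) S = B] v).
  apply: measurable_sum => B; apply: measurable_funM; first exact: measurable_cst.
  by apply: measurable_indic; exact: measurable_negative_points.
apply/funext => v; rewrite (bigD1 (negative_points (v *m M) S)) //= [X in _ + X]big1 ?addr0 =>
  [|B hB].
  rewrite indicE mem_set // mulr1 /G; case: pselect => [h|[]]; last by exists v.
  by case: cid => w /= hw; rewrite (ncoef_negative_points f hw).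
by rewrite indicE memNset ?mulr0 //= => h; rewrite h eqxx in hB.
Qed.

Lemma ncoef_bounded f S : exists C : R, forall u, `|(ncoef f S p u)%:~R : R| <= C.
Proof.
exists (\sum_(I : {set {i : 'I_N | i \in S}}) 1) => u.
rewrite /ncoef red_eulerE intrM normrM -intr_norm normrX normrN1 expr1n mul1r rmorph_sum.
apply: le_trans (ler_norm_sum _ _ _) _; rewrite big_mkcond; apply: ler_sum => I _.
by case: ifP => // _; rewrite -intr_norm normrX normrN1 expr1n.
Qed.

End CoefficientN.

Section NuIntegral.
Variables (R : realType) (N d : nat) (p : 'I_N -> 'rV[R]_d).
Implicit Types (f g : fba 'I_N) (S I J : {set 'I_N}).
Local Notation lam := (lebesgueV R).

Lemma measurable_usphere n : measurable (usphere R n).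
Proof.
have := measurable_enorm_powR (R := R) (d := n) 1 measurableT (measurable_set1 1).
rewrite setTI; congr measurable; apply/seteqP.
by split => x /=; rewrite powRr1 ?sqrtr_ge0.
Qed.

Lemma spherical_measure_fin n (A : set 'rV[R]_n) : measurable A -> (spherical_measure R n A <
  +oo)%E.
Proof.
move=> mA; apply: (@le_lt_trans _ _ (n%:R%:E * lam n (eball 1))%E);
  last by rewrite kappaE -EFinM ltry.
apply: lee_wpmul2l; first by rewrite lee_fin ler0n.
apply: le_measure; rewrite ?inE; last exact: subIsetr.
  apply: measurableI; last exact: measurable_eball.
  by apply: measurable_preimageT => //; exact: measurable_normalize.
exact: measurable_eball.
Qed.

Lemma ncoef_integrable f m (M : 'M[R]_(m, d)) S :
  (spherical_measure R m).-integrable (usphere R m)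
    (EFin \o (fun v => (ncoef f S p (v *m M))%:~R)).
Proof.
apply: measurable_bounded_integrable.
- exact: measurable_usphere.
- by apply: spherical_measure_fin; exact: measurable_usphere.
- by apply: measurable_funTS; exact: measurable_ncoef.
have [C hC] := ncoef_bounded p f S.
exists C; split; first exact: num_real.
by move=> x Cx v _; apply: le_trans (ltW Cx); exact: hC.
Qed.

Lemma nu_setU k f g S : nu k (f :|: g) S p = nu k f S p + nu k g S p - nu k (f :&: g) S p.
Proof.
rewrite /nu -mulrDr -mulrBr; congr (_ * _).
have mU := @measurable_usphere (d - k).
have iD h := @ncoef_integrable h _ (perp_frame (d - k) p S) S.
rewrite -RintegralD // -RintegralB //.
  by apply: eq_Rintegral => v _; rewrite ncoefU intrB intrD.
exact: (integrableD mU (iD f) (iD g)).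
Qed.

Lemma nu_set0 k S : nu k finset.set0 S p = 0.
Proof.
rewrite /nu (eq_Rintegral _ (g := cst 0)); last by move=> v _; rewrite ncoef0.
by rewrite /Rintegral integral0 mulr0.
Qed.

Lemma nu_setT k S : S != finset.set0 -> nu k [set: {set 'I_N}]%SET S p = 0.
Proof.
move=> S0; rewrite /nu (eq_Rintegral _ (g := cst 0)); last by move=> v _; rewrite ncoefT.
by rewrite /Rintegral integral0 mulr0.
Qed.

(** The cone over the spherical region is the cap without its apex, which is negligible. *)
Lemma spherical_cone k I S : (k < d)%N ->
  spherical_measure R (d - k)
    ([set v | ncone p I S (v *m perp_frame (d - k) p S)] `&` usphere R (d - k))
  = ((d - k)%:R * ext_angle p k I S)%:E.
Proof.
move=> kd; have dk : (0 < d - k)%N by rewrite subn_gt0.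
rewrite /spherical_measure EFinM; congr (_ * _)%E.
rewrite fineK ?ge0_fin_numE ?cone_cap_fin //.
set C := [set v | _] `&` _.
have -> : @normalize R (d - k) @^-1` C `&` eball 1 = cone_cap p k I S 1 `\` [set 0].
  apply/seteqP; split => w /=.
    move=> [[h1 h2] h3].
    have w0 : w != 0.
      apply/eqP => w0; move: h2; rewrite /usphere /normalize /= w0 scaler0 /enorm dotv0l sqrtr0.
      by move/esym/eqP; rewrite oner_eq0.
    have nw : 0 < (enorm w)^-1.
      rewrite invr_gt0 lt_neqAle sqrtr_ge0 andbT; apply/eqP => h.
      by move/eqP: w0; apply; apply: enorm_eq0; rewrite -h.
    split; last by move/eqP: w0.
    by split => //; move: h1; rewrite /normalize /= -scalemxAl => /(ncone_scale _ _ _ _ nw).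
  move=> [[h1 h2] w0].
  have nw : 0 < enorm w.
    rewrite lt_neqAle sqrtr_ge0 andbT; apply/eqP => h.
    by apply: w0; apply: enorm_eq0; rewrite -h.
  have nw' : 0 < (enorm w)^-1 by rewrite invr_gt0.
  split => //; split; rewrite /normalize /=.
    by rewrite -scalemxAl; apply/ncone_scale.
  by rewrite /usphere /= enormZ ?(ltW nw') // mulVf // gt_eqF.
have mc := @measurable_cone_cap R N d p k I S 1.
rewrite [RHS](measureDI _ mc (@measurable_origin R (d - k))).
rewrite [X in (_ + X)%E](_ : _ = 0%E) ?adde0 //.
apply/eqP; rewrite eq_le measure_ge0 andbT -(lebesgueV_origin R dk).
apply: le_measure; rewrite ?inE; last exact: subIsetr.
  by apply: measurableI => //; exact: measurable_origin.
exact: measurable_origin.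
Qed.

Lemma nu_uI k I S : (k < d)%N -> S != finset.set0 -> \rank (dirmx p S) = k ->
  nu k (uI I) S p = if S \subset I then ext_angle p k I S / kappa R (d - k) else 0.
Proof.
move=> kd S0 rS; have dk : (0 < d - k)%N by rewrite subn_gt0.
have [FF FD] := perp_frameP S0 rS.
have [i0 iS0 b0] := baseP p S0.
set F := perp_frame (d - k) p S in FF FD.
have perp v i j : i \in S -> j \in S -> dotv (p i) (v *m F) = dotv (p j) (v *m F).
  move=> iS jS; apply/eqP; rewrite -subr_eq0 -dotvBl.
  have /submxP[W ->] := dirmx_diff p iS jS.
  by rewrite dotv_mulmx -mulmxA FD mulmx0 dotvC dotv0l.
have nE v : ncoef (uI I) S p (v *m F) = ((S \subset I) && `[< ncone p I S (v *m F) >])%:R.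
  rewrite ncoef_uI //; congr ((_ && _)%:R); apply/forall_inP/asboolP => [h|[_ h] j jIS].
    split=> [i j|i j iIS jS]; first exact: perp.
    have := h i iIS; rewrite dotvBl subr_lt0.
    by rewrite (perp v (head i (enum S)) j) ?(head_mem _ iS0).
  by rewrite dotvBl subr_lt0; apply: h => //; exact: head_mem iS0.
rewrite /nu; case: ifPn => [SI|SI]; last first.
  rewrite (eq_Rintegral _ (g := cst 0)); last by move=> v _; rewrite nE (negbTE SI).
  by rewrite /Rintegral integral0 mulr0.
have mC : measurable [set v | ncone p I S (v *m F)].
  exact: (measurable_preimageT (measurable_mulmx F) (measurable_ncone p I S)).
rewrite (eq_Rintegral _ (g := \1_[set v | ncone p I S (v *m F)])); last first.
  move=> v _; rewrite nE SI indicE /=.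
  have -> : (v \in [set v | ncone p I S (v *m F)]) = `[< ncone p I S (v *m F) >].
    by apply/idP/asboolP; rewrite inE.
  by case: asbool.
rewrite /Rintegral integral_indic //; last exact: measurable_usphere.
transitivity ((((d - k)%:R * kappa R (d - k))^-1) * fine ((d - k)%:R * ext_angle p k I S)%:E).
  by congr (_ * fine _); exact: spherical_cone.
by rewrite /= mulrC -mulf_div divff ?mul1r // pnatr_eq0 -lt0n.
Qed.

(** Read in k orthonormal coordinates, the hull lies in a proper affine subspace. *)
Lemma kvol_degenerate k S : (k <= d)%N -> S != finset.set0 -> (\rank (dirmx p S) < k)%N ->
  kvol k (points_hull p S) = 0.
Proof.
move=> kd S0 rS; have [|q [E [EE hE ->]]] := @kvol_frame R N d p S k S0.
  by rewrite (ltnW rS).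
rewrite (@lebesgueV_flat _ _ _ (dirmx p S *m E^T) ((basepoint p S - q) *m E^T)) //.
- apply: measurable_preimageT; [exact: measurable_affine|exact: measurable_hull].
- exact: leq_ltn_trans (mxrankM_maxl _ _) rS.
move=> v /= /hull_dirmx h.
rewrite (_ : v - _ = (q + v *m E - basepoint p S) *m E^T); first exact: submxMr.
rewrite -[in LHS](mulmx1 v) -EE mulmxA -mulmxBl; congr (_ *m _).
by rewrite opprB addrA [v *m E + q]addrC.
Qed.

End NuIntegral.

Theorem theorem2 (R : realType) (N k d : nat) (f : fba 'I_N)
    (p : 'I_N -> 'rV[R]_d) (hN : (1 <= N)%N) (hd : (k + 1 <= d)%N)
    (hp : forall S : {set 'I_N}, #|S| = (k + 2)%N -> aff_indep p S) :
  bool_intrinsic_volume k p f =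
  \sum_(S : {set 'I_N} | #|S| == (k + 1)%N)
     nu k f S p * kvol k (points_hull p S).
Proof.
have kd : (k < d)%N by rewrite -addn1.
pose W (g : fba 'I_N) : R := \sum_(S : {set 'I_N} | #|S| == (k + 1)%N)
  nu k g S p * kvol k (points_hull p S).
have card0 (S : {set 'I_N}) : #|S| == (k + 1)%N -> S != finset.set0.
  by move=> cS; rewrite -card_gt0 (eqP cS) addn1.
rewrite /bool_intrinsic_volume.
rewrite (@ext0_basis _ (Ordinal hN) R W) //.
- move=> g h; rewrite /W -big_split -sumrB; apply: eq_bigr => S _.
  by rewrite nu_setU mulrBl mulrDl.
- by rewrite /W big1 // => S _; rewrite nu_set0 mul0r.
- by rewrite /W big1 // => S /card0 S0; rewrite nu_setT // mul0r.
move=> I I0; rewrite intrinsic_volume_hull ?(ltnW kd) // /W.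
rewrite mulr_suml big_mkcond [RHS]big_mkcond /=; apply: eq_bigr => S _.
have [S0|S0] := eqVneq S finset.set0.
  by rewrite S0 inE eqxx andbF /= cards0 addn1.
rewrite inE S0 andbT.
have [rS|rS] := eqVneq (\rank (dirmx p S)) k.
  have -> : #|S| = (k + 1)%N.
    by rewrite addn1; apply: rank_dirmx_card rS => // S' cS'; apply: hp; rewrite cS' addn2.
  rewrite eqxx nu_uI // andbT; case: ifP => _; last by rewrite mul0r.
  by rewrite [LHS]mulrC mulrA.
rewrite andbF; case: ifP => // /eqP cS; rewrite kvol_degenerate ?mulr0 ?(ltnW kd) //.
by have := rank_dirmx_lt p S0; rewrite cS addn1 ltnS leq_eqVlt (negbTE rS).
Qed.
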